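(* Let $V$ be the complex vector space of meromorphic functions on $\mathbb{C}$, let $A = \frac{d}{dz}: V\to V$, let $B = [b_{ij}]\in\mathbb{C}^{n\times n}$ and $\vec{\varphi} = [\varphi_1\ \ldots\ \varphi_n]^T\in V^{n\times 1}$. Suppose that $\varphi_1$ is the only differentially transcendental component of $\vec{\varphi}$, and let $\vec{x} = [x_1\ \ldots\ x_n]^T\in V^{n\times 1}$ be a solution of the system $$A(x_i) = b_{i1}x_1 + b_{i2}x_2+\ldots + b_{in}x_n + \varphi_i,\qquad 1\le i\le n.$$ Let $k\in\{2,\ldots,n\}$. Then the coordinate $x_k$ is differentially algebraic if and only if no function $A^{n-j}(\varphi_1)$ ($j=1,\ldots,n$) appears in the sum $$\sum_{j=1}^n (-1)^{j-1}\,\delta_j^k\big(B;\vec{A}^{\,n-j}(\vec{\varphi})\big).$$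
   Context: A function $x\in V$ is differentially algebraic if it satisfies a (nontrivial) differential algebraic equation with coefficients from $\mathbb{C}$, i.e. there exist $m\ge 0$ and a nonzero polynomial $P\in\mathbb{C}[y_0,\ldots,y_m]$ with $P(x,x',\ldots,x^{(m)})=0$; otherwise $x$ is differentially transcendental. ''$\varphi_1$ is the only differentially transcendental component'' means that $\varphi_1$ is differentially transcendental and $\varphi_2,\ldots,\varphi_n$ are differentially algebraic. $\vec{A}^{\,m}(\vec{\varphi}) = [A^m(\varphi_1)\ \ldots\ A^m(\varphi_n)]^T$, with $A^0$ the identity. For a square matrix $M$ of order $n$ and $1\le k,j\le n$, $\delta_j^k(M)$ denotes the sum of the principal minors of $M$ of order $j$ containing the $k$th column. For a column $\vec{v}=[v_1\ \ldots\ v_n]^T$ (with entries in $\mathbb{C}$ or in $V$), $\delta_j^k(B;\vec{v})$ denotes $\delta_j^k$ of the matrix obtained from $B$ by substituting $\vec{v}$ in place of the $k$th column; expanding along this column, $\delta_j^k(B;\vec{v}) = \sum_{s=1}^n \delta_j^k(B;\vec{e}_s)\,v_s$, where $\vec{e}_s\in\mathbb{C}^{n\times 1}$ is the $s$th standard basis column. Accordingly, the sum in the claim equals $\sum_{j=1}^n\sum_{s=1}^n (-1)^{j-1}\delta_j^k(B;\vec{e}_s)\,A^{n-j}(\varphi_s)$, and ''no function $A^{n-j}(\varphi_1)$ appears in the sum'' means that in this expression the coefficient of $A^{n-j}(\varphi_1)$ is zero for every $j$, i.e. $\delta_j^k(B;\vec{e}_1)=0$ for all $j=1,\ldots,n$.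 *)

(* Defs.v *)
From HB Require Import structures.
From mathcomp Require Import all_boot all_order all_algebra.
From mathcomp Require Import complex.
(* mpoly's notations are incompatible with those of mathcomp-analysis *)
From mathcomp Require Import -(notations) mpoly.
From mathcomp Require Import all_classical all_reals all_analysis.

Set Implicit Arguments.
Unset Strict Implicit.
Unset Printing Implicit Defensive.

Import Order.TTheory GRing.Theory Num.Theory.
Import numFieldNormedType.Exports.

Local Open Scope classical_set_scope.
Local Open Scope ring_scope.

(* The field R[i], packaged as a numClosedFieldType: in this form (and not as
   the bare type R[i]) it inherits the topology and the normed module structure
   over itself, so that derivable _ _ 1 and derive1 are the complex notions. *)
Definition Cplx (R : realType) : numClosedFieldType := R[i].

Section Meromorphic.
Variable R : realType.
Local Notation C := (Cplx R).

Definition holomorphic_at (g : C -> C) (a : C) : Prop :=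
  \forall z \near a, derivable g z 1.

(* Meromorphic functions on the whole plane are represented by total functions
   whose values on a closed discrete set (containing the poles) are irrelevant:
   at every point a, (z - a)^m f(z) extends holomorphically through a for some
   m. *)
Definition meromorphic (f : C -> C) : Prop :=
  forall a : C, exists (m : nat) (g : C -> C),
    holomorphic_at g a /\ \forall z \near a^', (z - a) ^+ m * f z = g z.

(* Equality of meromorphic functions: two representatives are identified when
   they agree off a closed discrete set. The derivative is derive1, whose
   iterates respect this identification. *)
Definition meq (f g : C -> C) : Prop :=
  forall a : C, \forall z \near a^', f z = g z.

Definition diff_algebraic (x : C -> C) : Prop :=
  exists (m : nat) (P : mpoly m.+1 C),
    P != 0 /\
    meq (fun z => meval (fun i : 'I_m.+1 => derive1n i x z) P) (fun=> 0).

Definition diff_transcendental (x : C -> C) : Prop := ~ diff_algebraic x.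

End Meromorphic.

Section Minors.
Variables (K : comNzRingType) (n : nat).

Definition principal_minor (M : 'M[K]_n) (S : {set 'I_n}) : K :=
  \det (mxsub (fun i : 'I_#|S| => enum_val i) (fun i : 'I_#|S| => enum_val i) M).

Definition delta (j : nat) (k : 'I_n) (M : 'M[K]_n) : K :=
  \sum_(S : {set 'I_n} | (#|S| == j) && (k \in S)) principal_minor M S.

Definition subst_col (k : 'I_n) (v : 'cV[K]_n) (M : 'M[K]_n) : 'M[K]_n :=
  \matrix_(i, l) (if l == k then v i 0 else M i l).

(* The coefficient of A^(n-j)(phi_s) in
     \sum_(1 <= j <= n) (-1)^(j-1) delta_j^k(B; A^(n-j)(phi)),
   obtained by expanding each delta_j^k along the substituted k-th column. *)
Definition sum_coef (B : 'M[K]_n) (k : 'I_n) (j : nat) (s : 'I_n) : K :=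
  (-1) ^+ j.-1 * delta j k (subst_col k (delta_mx s 0) B).

End Minors.

(* Main.v *)
Require Import Defs.
From HB Require Import structures.
From mathcomp Require Import all_boot all_order all_algebra.
From mathcomp Require Import complex.
From mathcomp Require Import -(notations) mpoly.
From mathcomp Require Import all_classical all_reals all_analysis.
From mathcomp Require Import ring lra.
From mathcomp Require Import perm.

Set Implicit Arguments.
Unset Strict Implicit.
Unset Printing Implicit Defensive.

Import Order.TTheory GRing.Theory Num.Theory.
Import numFieldNormedType.Exports.

Local Open Scope classical_set_scope.
Local Open Scope ring_scope.

(** Write the system as (d - B) x = phi, where d is the derivation, and multiply
    by the adjugate of the characteristic matrix X - B evaluated at d.  With
    p the characteristic polynomial of B this gives
      p(d) x_k = sum_s adj_(k,s)(d) phi_s                [system_elimination],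
    and expanding the determinant adj_(k,s) in principal minors shows that its
    coefficient of X^(n-j) is exactly (-1)^(j-1) delta_j^k(B; e_s)
    [adj_char_coef].  So the sum in the theorem does not involve phi_1, which is
    phi ord0, exactly when the operator q = adj_(k,1)(d) in front of phi_1 is
    zero.

    The rest is a transcendence degree count.  If y satisfies a linear equation
    L(d) y = sum_s L_s(d) y_s with L nonzero, constant coefficients and all y_s
    differentially algebraic, then all derivatives of y and of the y_s are
    algebraic over a field generated by finitely many elements, so finitely many
    derivatives of y are algebraically dependent and y is differentially
    algebraic [diffalg_linear].  If q = 0, this applies to y = x_k with L = p,
    since phi_1 is then absent.  If q is nonzero and x_k were differentially
    algebraic, it would apply to y = phi_1 with L = q, although phi_1 is
    differentially transcendental.

    The count takes place in a differential field, so meromorphic functions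
    modulo equality off a discrete set have to form one.  Two facts about a
    function g that is complex differentiable near a are behind this: g' is again
    differentiable near a [holomorphic_derive1], and g either vanishes near a or
    is (z - a)^m h with h(a) nonzero [holomorphic_zero_order].  The second gives
    the identity theorem [meromorphic_zero], hence inverses.  Both follow from
    Cauchy's formula, obtained here from finite sums.  The integral along a
    segment is the limit of the midpoint rules avg n; these are additive under
    bisection, so Goursat's subdivision argument can be run on the sums
    themselves [goursat].  Applied to f(w) / (w - z) between a diamond around z
    and its successive halvings towards z, it yields f(z) times the integral of
    1 / (w - z) [cauchy_formula]; that last integral is nonzero at the centre of
    the diamond [winding_neq0].  The kernel 1 / (w - z) can be differentiated and
    expanded in powers of z - a, and so can g. *)

(** * The real-valued modulus *)
Section ComplexModulus.
Variable R : realType.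
Local Notation C := (Cplx R).
Implicit Types (z w : C) (f g : C -> C).

(** The norm of Cplx R is an element of Cplx R, whose order is partial.  The same
    number read in R can be handled by linear arithmetic. *)
Definition cabs (z : C) : R := complex.Re `|z|.

Lemma cabsE z : `|z| = (cabs z)%:C%C.
Proof. by rewrite /cabs normc_def. Qed.

Lemma cabs_ge0 z : 0 <= cabs z.
Proof. by have := normr_ge0 z; rewrite cabsE (lecR 0). Qed.

Lemma cabs_eq0 z : (cabs z == 0) = (z == 0).
Proof. by rewrite -(normr_eq0 z) cabsE (inj_eq (@complexI R) (cabs z) 0). Qed.

Lemma cabs_gt0 z : (0 < cabs z) = (z != 0).
Proof. by rewrite lt_def cabs_eq0 cabs_ge0 andbT. Qed.

Lemma cabs0 : cabs 0 = 0.
Proof. by apply/eqP; rewrite cabs_eq0. Qed.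

Lemma cabsM z w : cabs (z * w) = cabs z * cabs w.
Proof. by apply: (@complexI R); rewrite rmorphM /= -!cabsE normrM. Qed.

Lemma cabsN z : cabs (- z) = cabs z.
Proof. by rewrite /cabs normrN. Qed.

Lemma cabsBC z w : cabs (z - w) = cabs (w - z).
Proof. by rewrite /cabs distrC. Qed.

Lemma cabsD z w : cabs (z + w) <= cabs z + cabs w.
Proof. by have := ler_normD z w; rewrite !cabsE -rmorphD lecR. Qed.

Lemma cabsB z w : cabs (z - w) <= cabs z + cabs w.
Proof. by rewrite -(cabsN w) cabsD. Qed.

Lemma cabs_triangle z w t : cabs (z - w) <= cabs (z - t) + cabs (t - w).
Proof. by apply: le_trans (cabsD _ _); rewrite addrA subrK. Qed.

Lemma cabsV z : cabs z^-1 = (cabs z)^-1.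
Proof. by apply: (@complexI R); rewrite fmorphV /= -!cabsE normfV. Qed.

Lemma cabs1 : cabs 1 = 1.
Proof. by rewrite /cabs normr1. Qed.

Lemma cabsX z n : cabs (z ^+ n) = cabs z ^+ n.
Proof. by elim: n => [|n IH]; rewrite ?cabs1// !exprS cabsM IH. Qed.

Lemma cabsR (r : R) : cabs (r%:C%C) = `|r|.
Proof. by rewrite /cabs normc_def /= expr0n addr0 sqrtr_sqr. Qed.

Lemma cabs2 : cabs 2 = 2.
Proof.
by rewrite (_ : (2 : C) = 2%:C%C) ?cabsR ?ger0_norm//; rewrite rmorph_nat.
Qed.

Lemma Re_le_cabs z : complex.Re z <= cabs z.
Proof.
have := normc_ge_Re z; rewrite cabsE lecR; apply: le_trans; exact: ler_norm.
Qed.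

Lemma near_cabsP (z : C) (P : set C) :
  (\forall w \near z, P w) <->
  (exists e : R, 0 < e /\ forall w, cabs (w - z) < e -> P w).
Proof.
split.
  move=> /nbhs_ballP [e /= e0 He].
  have eE : e = (complex.Re e)%:C%C.
    by move: e0; case: (e) => a b; rewrite ltcE /= => /andP[/eqP-> _].
  exists (complex.Re e); split; first by rewrite -ltcR -eE.
  move=> w wz; apply: He; rewrite -ball_normE /= cabsE eE ltcR cabsBC //.
move=> [e [e0 He]]; apply/nbhs_ballP; exists (e%:C%C); first by rewrite /= ltcR.
move=> w; rewrite -ball_normE /= cabsE ltcR cabsBC; exact: He.
Qed.

Lemma near_dnbhs_cabsP (z : C) (P : set C) :
  (\forall w \near z^', P w) <->
  (exists e : R, 0 < e /\ forall w, cabs (w - z) < e -> w != z -> P w).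
Proof.
rewrite /dnbhs /within /=; exact: near_cabsP.
Qed.

Lemma continuous_cabsP f z :
  {for z, continuous f} <->
  (forall e : R, 0 < e -> exists d : R, 0 < d /\
     forall w, cabs (w - z) < d -> cabs (f w - f z) < e).
Proof.
split.
  move=> cf e e0; have H := iffLR (cvgrPdist_lt (FF := nbhs_filter z) f (f z)) cf.
  have := H e%:C%C; rewrite (ltcR 0) => /(_ e0) /near_cabsP [d [d0 Hd]]; exists d; split=> // w /Hd.
  by rewrite cabsE ltcR cabsBC.
move=> H; suff : f w @[w --> z] --> f z by [].
apply/(cvgrPdist_lt (FF := nbhs_filter z)) => e e0.
have eE : e = (complex.Re e)%:C%C.
  by move: e0; case: (e) => a b; rewrite ltcE /= => /andP[/eqP-> _].
have [|d [d0 Hd]] := H (complex.Re e); first by rewrite -ltcR -eE.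
apply/near_cabsP; exists d; split=> // w /Hd.
by rewrite cabsE eE ltcR cabsBC.
Qed.

Lemma is_derive_cabsP f z (l : C) :
  is_derive z 1 f l <->
  (forall e : R, 0 < e -> exists d : R, 0 < d /\
     forall w, cabs (w - z) < d ->
       cabs (f w - f z - l * (w - z)) <= e * cabs (w - z)).
Proof.
have quotE h : h != 0 :> C ->
    l - h^-1 *: ((f \o shift z) (h *: (1 : C)) - f z) =
    - ((f (z + h) - f z - l * h) / h).
  by move=> h0; rewrite /= [h *: _]mulr1 [h + z]addrC [_ *: _]mulrC; field.
split.
  move=> [/cvgrPdist_lt df dl] e e0.
  have := df e%:C%C; rewrite (ltcR 0) => /(_ e0).
  have -> : lim (h^-1 *: ((f \o shift z) (h *: (1 : C)) - f z)
                   @[h --> 0^']) = l by exact: dl.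
  move=> /near_dnbhs_cabsP[d [d0 Hd]]; exists d; split=> // w wd.
  have [->|wz] := eqVneq w z; first by rewrite !subrr mulr0 subrr cabs0 mulr0.
  have h0 : w - z != 0 by rewrite subr_eq0.
  have := Hd (w - z); rewrite subr0 => /(_ wd h0).
  rewrite quotE// cabsE ltcR cabsN cabsM cabsV ltr_pdivrMr ?cabs_gt0//.
  by rewrite [z + _]addrC subrK => /ltW.
move=> H.
have cv : h^-1 *: ((f \o shift z) (h *: (1 : C)) - f z) @[h --> 0^'] --> l.
  apply/cvgrPdist_lt => e e0.
  have eE : e = (complex.Re e)%:C%C.
    by move: e0; case: (e) => a b; rewrite ltcE /= => /andP[/eqP-> _].
  have re0 : 0 < complex.Re e by rewrite -ltcR -eE.
  have [|d [d0 Hd]] := H (complex.Re e / 2); first by rewrite divr_gt0.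
  apply/near_dnbhs_cabsP; exists d; split=> // h; rewrite subr0 => hd h0.
  rewrite quotE// cabsE eE ltcR cabsN cabsM cabsV ltr_pdivrMr ?cabs_gt0//.
  have := Hd (z + h); rewrite [z + h - z]addrC addKr => /(_ hd) /le_lt_trans.
  by apply; rewrite ltr_pM2r ?cabs_gt0//; lra.
apply: DeriveDef; first by apply/cvg_ex; exists l.
exact: cvg_lim cv.
Qed.

End ComplexModulus.

(** * Dyadic averages along segments *)
Section Dyadic.
Variable R : realType.
Local Notation C := (Cplx R).
Implicit Types (p q z w : C) (f g : C -> C) (K : set C).

Lemma real_cauchy (u : nat -> R) :
  (forall e, 0 < e -> exists N, forall n, (N <= n)%N -> `|u n - u N| < e) ->
  exists l, forall e, 0 < e -> exists N, forall n, (N <= n)%N -> `|u n - l| < e.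
Proof.
move=> H; have cu : cvg (u @ \oo).
  apply/cauchy_cvgP/cauchy_exP => e e0; have [N HN] := H e e0.
  exists (u N); exists N => // n /= Nn; rewrite -ball_normE /= distrC; exact: HN.
exists (lim (u @ \oo)) => e e0.
have /cvgrPdist_lt /(_ e e0) [N _ HN] : u @ \oo --> lim (u @ \oo) by [].
by exists N => n Nn; rewrite distrC; apply: HN.
Qed.

Lemma abs_Re_le_cabs z : `|complex.Re z| <= cabs z.
Proof. by have := normc_ge_Re z; rewrite cabsE lecR. Qed.

Lemma abs_Im_le_cabs z : `|complex.Im z| <= cabs z.
Proof.
case: z => a b; rewrite /cabs normc_def /= -sqrtr_sqr ler_wsqrtr//.
by rewrite lerDr sqr_ge0.
Qed.

Lemma cabs_le_ReIm z : cabs z <= `|complex.Re z| + `|complex.Im z|.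
Proof.
case: z => a b /=.
have -> : (a +i* b)%C = a%:C%C + 'i%C * b%:C%C :> C.
  by apply/eqP; rewrite eq_complex /=; apply/andP; split; apply/eqP; ring.
apply: le_trans (cabsD _ _) _; rewrite cabsM !cabsR.
by rewrite (_ : cabs 'i%C = 1) ?mul1r// /cabs normc_def /= expr0n add0r expr1n sqrtr1.
Qed.

Lemma complex_cauchy (u : nat -> C) :
  (forall e, 0 < e ->
     exists N, forall n, (N <= n)%N -> cabs (u n - u N) < e) ->
  exists l, forall e, 0 < e ->
     exists N, forall n, (N <= n)%N -> cabs (u n - l) < e.
Proof.
move=> H.
have [a Ha] : exists l, forall e, 0 < e -> exists N, forall n, (N <= n)%N ->
    `|complex.Re (u n) - l| < e.
  apply: real_cauchy => e /H [N HN]; exists N => n /HN; apply: le_lt_trans.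
  by rewrite -raddfB; exact: abs_Re_le_cabs.
have [b Hb] : exists l, forall e, 0 < e -> exists N, forall n, (N <= n)%N ->
    `|complex.Im (u n) - l| < e.
  apply: real_cauchy => e /H [N HN]; exists N => n /HN; apply: le_lt_trans.
  by rewrite -raddfB; exact: abs_Im_le_cabs.
exists (a +i* b)%C => e e0; have e20 : 0 < e / 2 by lra.
have [N HN] := Ha _ e20; have [M HM] := Hb _ e20.
exists (maxn N M) => n; rewrite geq_max => /andP[/HN h1 /HM h2].
apply: le_lt_trans (cabs_le_ReIm _) _.
by rewrite !raddfB /= [e]splitr ltrD.
Qed.

Definition mid p q : C := (p + q) / 2.

(** The composite midpoint rule with 2 ^ n nodes for the mean value of f on the
    segment from p to q.  The recursive form makes it additive under bisection
    at every finite n, so that subdivision arguments involve no limit. *)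
Fixpoint avg n f p q : C :=
  if n is m.+1 then mid (avg m f p (mid p q)) (avg m f (mid p q) q)
  else f (mid p q).

Definition midconvex K := forall p q, K p -> K q -> K (mid p q).

(** Averages do not leave a midpoint-convex set.  With a disc as K' this is the
    bound avg_le; with a half-plane it is a positivity statement, used in
    winding_neq0. *)
Lemma avg_in n f p q K K' : midconvex K -> midconvex K' ->
  (forall w, K w -> K' (f w)) -> K p -> K q -> K' (avg n f p q).
Proof.
move=> mK mK' fK; elim: n p q => [|n IH] p q Kp Kq /=; first by apply/fK/mK.
by apply: mK'; apply: IH => //; apply: mK.
Qed.

Lemma eq_avg n f g p q K : midconvex K -> (forall w, K w -> f w = g w) ->
  K p -> K q -> avg n f p q = avg n g p q.
Proof.
move=> mK fg; elim: n p q => [|n IH] p q Kp Kq /=; first by apply/fg/mK.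
by rewrite !IH//; apply: mK.
Qed.

Lemma avgD n f g p q :
  avg n (fun w => f w + g w) p q = avg n f p q + avg n g p q.
Proof. by elim: n p q => //= n IH p q; rewrite !IH /mid; field. Qed.

Lemma avgZ n c f p q : avg n (fun w => c * f w) p q = c * avg n f p q.
Proof. by elim: n p q => //= n IH p q; rewrite !IH /mid; field. Qed.

Lemma midC p q : mid p q = mid q p.
Proof. by rewrite /mid addrC. Qed.

Lemma avg_sym n f p q : avg n f q p = avg n f p q.
Proof.
elim: n p q => [|n IH] p q /=; first by rewrite midC.
by rewrite (midC q p) midC (IH p) (IH _ q).
Qed.

Lemma avg_affine n (c d : C) p q :
  avg n (fun w => c + d * w) p q = c + d * mid p q.
Proof. by elim: n p q => //= n IH p q; rewrite !IH /mid; field. Qed.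

Lemma avg_homothety n f z (s : C) p q :
  avg n f (z + s * (p - z)) (z + s * (q - z)) =
  avg n (fun w => f (z + s * (w - z))) p q.
Proof.
have mE p' q' : mid (z + s * (p' - z)) (z + s * (q' - z)) =
    z + s * (mid p' q' - z) by rewrite /mid; field.
by elim: n p q => [|n IH] p q /=; rewrite mE// !IH.
Qed.

Lemma midconvexI K K' : midconvex K -> midconvex K' -> midconvex (K `&` K').
Proof. by move=> mK mK' p q [? ?] [? ?]; split; [apply: mK|apply: mK']. Qed.

Lemma midconvex_disc z (r : R) : midconvex [set w | cabs (w - z) <= r].
Proof.
move=> p q /= hp hq.
rewrite (_ : mid p q - z = (p - z) / 2 + (q - z) / 2); last by rewrite /mid; field.
by apply: le_trans (cabsD _ _) _; rewrite !cabsM cabsV cabs2; lra.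
Qed.

Lemma midconvexT : midconvex setT. Proof. by []. Qed.

Lemma avg_le n f p q K (M : R) : midconvex K ->
  (forall w, K w -> cabs (f w) <= M) -> K p -> K q -> cabs (avg n f p q) <= M.
Proof.
move=> mK fM Kp Kq.
have fM' w : K w -> [set w | cabs (w - 0) <= M] (f w).
  by move=> /fM /=; rewrite subr0.
by have /= := avg_in n mK (@midconvex_disc 0 M) fM' Kp Kq; rewrite subr0.
Qed.

(** Closedness of K, in terms of the real modulus. *)
Definition adherent K := forall z,
  (forall e, 0 < e -> exists w, K w /\ cabs (w - z) < e) -> K z.

Definition perim a b c : R := cabs (b - a) + cabs (c - b) + cabs (a - c).

Lemma perim_ge0 a b c : 0 <= perim a b c.
Proof. by rewrite /perim !addr_ge0 ?cabs_ge0. Qed.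

Lemma perim_sub a b c :
  [/\ perim a (mid a b) (mid c a) = perim a b c / 2,
      perim (mid a b) b (mid b c) = perim a b c / 2,
      perim (mid c a) (mid b c) c = perim a b c / 2 &
      perim (mid a b) (mid b c) (mid c a) = perim a b c / 2].
Proof.
have h z w t : z = w / 2 -> t = cabs w / 2 -> cabs z = t.
  by move=> -> ->; rewrite cabsM cabsV cabs2.
have h' z w t : z = - w / 2 -> t = cabs w / 2 -> cabs z = t.
  by move=> -> ->; rewrite mulNr cabsN cabsM cabsV cabs2.
have E (x y t u v s : R) : x = u / 2 -> y = v / 2 -> t = s / 2 ->
  x + y + t = (u + v + s) / 2 by move=> -> -> ->; field.
have P2 (x y t u v s : R) : x = s / 2 -> y = u / 2 -> t = v / 2 ->
  x + y + t = (u + v + s) / 2 by move=> -> -> ->; field.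
split; rewrite /perim.
- by apply: E; (apply: h; [|by []]); rewrite /mid; field.
- by apply: E; (apply: h; [|by []]); rewrite /mid; field.
- by apply: E; (apply: h; [|by []]); rewrite /mid; field.
- by apply: P2; (apply: h'; [|by []]); rewrite /mid; field.
Qed.

End Dyadic.

(** * Goursat's lemma *)
Section Goursat.
Variable R : realType.
Local Notation C := (Cplx R).
Implicit Types (a b c p q z w : C) (f g : C -> C) (K : set C).

Lemma exp2_small (x e : R) : 0 < e -> exists N, x / 2 ^+ N < e.
Proof.
move=> e0; exists (Num.bound (x / e)).
rewrite ltr_pdivrMr ?exprn_gt0// mulrC -ltr_pdivrMr//.
exact: upper_nthrootP.
Qed.

(** If P failed for a triangle, it would fail for one of its four midpoint
    triangles, and so on; these nested triangles shrink to a point z of K, against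
    the local hypothesis at z.  The distance from z to each of them is at most
    its perimeter, which makes first-order estimates at z relevant to them.
    On a degenerate triangle a b b this is bisection of a segment. *)
Lemma triangle_cousin K (P : C -> C -> C -> Prop) :
  adherent K -> midconvex K ->
  (forall a b c, P a (mid a b) (mid c a) -> P (mid a b) b (mid b c) ->
     P (mid c a) (mid b c) c -> P (mid a b) (mid b c) (mid c a) -> P a b c) ->
  (forall z, K z -> exists d : R, 0 < d /\ forall a b c, K a -> K b -> K c ->
     cabs (a - z) <= perim a b c -> perim a b c < d -> P a b c) ->
  forall a b c, K a -> K b -> K c -> P a b c.
Proof.
move=> adK mK Psub Ploc a b c Ka Kb Kc; apply: contrapT => nP.
pose bad (T : C * C * C) :=
  [/\ K T.1.1, K T.1.2, K T.2 & ~ P T.1.1 T.1.2 T.2].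
pose per (T : C * C * C) := perim T.1.1 T.1.2 T.2.
(* The vertex a moves by no more than the loss of perimeter, so the distances
   travelled telescope. *)
pose next (T T' : C * C * C) := bad T ->
  [/\ bad T', per T' = per T / 2 & cabs (T'.1.1 - T.1.1) <= per T - per T'].
have [h gP] : {h & forall T, next T (h T)}.
  apply: choice => -[[x y] t]; case: (pselect (bad (x, y, t))); last first.
    by move=> nb; exists (x, y, t).
  move=> [/= Kx Ky Kt nPt]; have [E1 E2 E3 E4] := perim_sub x y t.
  have Kxy := mK _ _ Kx Ky; have Kyt := mK _ _ Ky Kt; have Ktx := mK _ _ Kt Kx.
  have hp : 0 <= perim x y t by exact: perim_ge0.
  have hxy : cabs (mid x y - x) <= perim x y t - perim x y t / 2.
    rewrite (_ : mid x y - x = (y - x) / 2); last by rewrite /mid; field.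
    rewrite cabsM cabsV cabs2 /perim.
    by have := cabs_ge0 (t - y); have := cabs_ge0 (x - t); lra.
  have htx : cabs (mid t x - x) <= perim x y t - perim x y t / 2.
    rewrite (_ : mid t x - x = - (x - t) / 2); last by rewrite /mid; field.
    rewrite cabsM cabsN cabsV cabs2 /perim.
    by have := cabs_ge0 (t - y); have := cabs_ge0 (y - x); lra.
  have [p1|n1] := pselect (P x (mid x y) (mid t x)); last first.
    exists (x, mid x y, mid t x) => _; split=> //=.
    by rewrite /per/= E1 subrr cabs0; lra.
  have [p2|n2] := pselect (P (mid x y) y (mid y t)); last first.
    by exists (mid x y, y, mid y t) => _; split=> //=; rewrite /per/= E2.
  have [p3|n3] := pselect (P (mid t x) (mid y t) t); last first.
    by exists (mid t x, mid y t, t) => _; split=> //=; rewrite /per/= E3.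
  have [p4|n4] := pselect (P (mid x y) (mid y t) (mid t x)); last first.
    by exists (mid x y, mid y t, mid t x) => _; split=> //=; rewrite /per/= E4.
  by case: nPt; apply: Psub.
pose u n := iter n h (a, b, c); pose r := perim a b c.
have ub n : bad (u n).
  by elim: n => [|n IH]; [split|have [] := gP _ IH].
have up n : per (u n) = r / 2 ^+ n.
  elim: n => [|n IH]; first by rewrite expr0 divr1.
  have [_ -> _] := gP _ (ub n); rewrite -/(u n) IH exprS; field.
  by rewrite expf_neq0.
have ua n k : cabs ((u (n + k)%N).1.1 - (u n).1.1) <= per (u n) - per (u (n + k)%N).
  elim: k => [|k IH]; first by rewrite addn0 !subrr cabs0.
  rewrite addnS; have [_ _] := gP _ (ub (n + k)%N); rewrite -[h _]/(u (n + k).+1).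
  by have := cabs_triangle (u (n + k).+1).1.1 (u n).1.1 (u (n + k)%N).1.1; lra.
have ua' n m : (n <= m)%N -> cabs ((u m).1.1 - (u n).1.1) <= per (u n).
  move=> /subnKC <-; apply: le_trans (ua _ _) _.
  by rewrite lerBlDr lerDl perim_ge0.
have [z zP] : exists l, forall e, 0 < e ->
    exists N, forall n, (N <= n)%N -> cabs ((u n).1.1 - l) < e.
  apply: complex_cauchy => e e0; have [N HN] := exp2_small r e0.
  by exists N => n Nn; apply: le_lt_trans (ua' _ _ Nn) _; rewrite up.
have uz n : cabs ((u n).1.1 - z) <= per (u n).
  apply/ler_addgt0Pr => e e0; have [N HN] := zP _ e0.
  have h1 := HN _ (leq_maxr n N); have h2 := ua' _ _ (leq_maxl n N).
  have := cabs_triangle (u n).1.1 z (u (maxn n N)).1.1.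
  by rewrite [cabs (_ - (u (maxn _ _)).1.1)]cabsBC; lra.
have Kz : K z.
  apply: adK => e e0; have [N HN] := zP _ e0; exists (u N).1.1; split; last exact: HN.
  by have [] := ub N.
have [d [d0 Hd]] := Ploc _ Kz; have [N HN] := exp2_small r d0.
have [K1 K2 K3 nPu] := ub N; apply: nPu; apply: Hd K1 K2 K3 (uz N) _.
by have := up N; rewrite /per => ->.
Qed.

(** Connectedness of the plane: bisect the segment from a to b. *)
Lemma clopen_total (Z : set C) :
  (forall z, (\forall w \near z, Z w) \/ (\forall w \near z, ~ Z w)) ->
  forall a b, Z a -> Z b.
Proof.
move=> H a b; pose P (a b c : C) := Z a -> Z b.
apply: (@triangle_cousin setT P _ (@midconvexT R) _ _ a b b) => //.
- by move=> x y t h1 h2 _ _ /h1/h2.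
move=> z _; have [/near_cabsP|/near_cabsP] := H z => -[e [e0 He]].
all: exists (e / 2); split=> [|x y t _ _ _ h1 h2]; first lra.
  move=> _; apply: He; have := cabs_triangle y z x; move: h2 h1; rewrite /perim.
  by have := cabs_ge0 (t - y); have := cabs_ge0 (x - t); lra.
move=> Zx; suff : ~ Z x by [].
by apply: He; lra.
Qed.

(** For a small oscillation bound, a segment near a given point has all its
    averages close to one value, and closeness of the averages for large n passes
    from the two halves of a segment to the whole. *)
Lemma avg_cauchy K f p q : adherent K -> midconvex K ->
  (forall z, K z -> {for z, continuous f}) -> K p -> K q ->
  forall e, 0 < e -> exists N, forall n, (N <= n)%N ->
    cabs (avg n f p q - avg N f p q) < e.
Proof.
move=> adK mK cf Kp Kq e e0; have e20 : 0 < e / 2 by lra.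
pose P (a b c : C) := exists N, forall n m, (N <= n)%N -> (N <= m)%N ->
  cabs (avg n f a b - avg m f a b) <= e / 2.
suff [N HN] : P p q q.
  by exists N => n Nn; apply: le_lt_trans (HN _ _ Nn (leqnn _)) _; lra.
apply: (triangle_cousin adK mK) => // [x y t [N1 H1] [N2 H2] _ _|z Kz].
  exists (maxn N1 N2).+1 => -[//|n] [//|m]; rewrite !ltnS !geq_max /=.
  move=> /andP[n1 n2] /andP[m1 m2].
  rewrite (_ : _ - _ = (avg n f x (mid x y) - avg m f x (mid x y)) / 2 +
      (avg n f (mid x y) y - avg m f (mid x y) y) / 2); last by rewrite /mid; field.
  apply: le_trans (cabsD _ _) _; rewrite !cabsM cabsV cabs2.
  by have := H1 _ _ n1 m1; have := H2 _ _ n2 m2; lra.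
have e40 : 0 < e / 4 by lra.
have [d [d0 Hd]] := iffLR (continuous_cabsP _ _) (cf _ Kz) _ e40.
exists (d / 2); split=> [|a b c Ka Kb Kc az abc]; first lra.
exists 0%N => n m _ _.
have bz : cabs (b - z) <= d / 2 + d / 2 - (d / 2 - perim a b c).
  have := cabs_triangle b z a; move: az abc; rewrite /perim.
  by have := cabs_ge0 (c - b); have := cabs_ge0 (a - c); lra.
pose D := [set w | cabs (w - z) <= d / 2 + d / 2 - (d / 2 - perim a b c)].
have key k : cabs (avg k f a b - f z) <= e / 4.
  have fD w : D w -> [set y | cabs (y - f z) <= e / 4] (f w).
    by rewrite /D /= => wz; apply/ltW/Hd; lra.
  apply: (avg_in k (@midconvex_disc _ z _) (@midconvex_disc _ (f z) (e / 4)) fD) => //.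
  by rewrite /D /=; lra.
have := cabs_triangle (avg n f a b) (avg m f a b) (f z).
by rewrite [cabs (f z - _)]cabsBC; have := key n; have := key m; lra.
Qed.

(** The n-th midpoint sum for the integral of f along the boundary of a b c. *)
Definition contour n f a b c : C :=
  (b - a) * avg n f a b + (c - b) * avg n f b c + (a - c) * avg n f c a.

(** The edges of the inner triangle are travelled twice, in opposite directions,
    and avg is symmetric in its endpoints, so they cancel exactly. *)
Lemma contourS n f a b c : contour n.+1 f a b c =
  contour n f a (mid a b) (mid c a) + contour n f (mid a b) b (mid b c) +
  contour n f (mid c a) (mid b c) c + contour n f (mid a b) (mid b c) (mid c a).
Proof.
rewrite /contour /=.
rewrite (avg_sym n f (mid a b) (mid c a)) (avg_sym n f (mid a b) (mid b c)).
by rewrite (avg_sym n f (mid b c) (mid c a)) /mid; field.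
Qed.

Lemma contour_le n f a b c K (M : R) : midconvex K ->
  (forall w, K w -> cabs (f w) <= M) -> K a -> K b -> K c ->
  cabs (contour n f a b c) <= perim a b c * M.
Proof.
move=> mK fM Ka Kb Kc; rewrite /contour /perim 2![in leRHS]mulrDl.
apply: le_trans (cabsD _ _) (lerD _ _).
  apply: le_trans (cabsD _ _) (lerD _ _).
    by rewrite cabsM ler_wpM2l ?cabs_ge0//; apply: avg_le fM Ka Kb.
  by rewrite cabsM ler_wpM2l ?cabs_ge0//; apply: avg_le fM Kb Kc.
by rewrite cabsM ler_wpM2l ?cabs_ge0//; apply: avg_le fM Kc Ka.
Qed.

(** On a small triangle near z, f is affine up to an error e * perim.  The affine
    part contributes nothing to the sum, which is therefore at most e * perim ^ 2;
    and the squared perimeters of the four midpoint triangles add up to that of the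
    whole triangle, so triangle_cousin propagates this bound. *)
Lemma goursat K f a b c : adherent K -> midconvex K ->
  (forall z, K z -> derivable f z 1) -> K a -> K b -> K c ->
  forall e, 0 < e -> exists N, forall n, (N <= n)%N ->
    cabs (contour n f a b c) < e.
Proof.
move=> adK mK df Ka Kb Kc.
have key e : 0 < e -> exists N, forall n, (N <= n)%N ->
    cabs (contour n f a b c) <= e * perim a b c ^+ 2.
  move=> e0.
  apply: (triangle_cousin (P := fun a b c => exists N, forall n, (N <= n)%N ->
    cabs (contour n f a b c) <= e * perim a b c ^+ 2) adK mK) => //.
    move=> x y t [N1 H1] [N2 H2] [N3 H3] [N4 H4].
    exists (maxn (maxn N1 N2) (maxn N3 N4)).+1 => -[//|n].
    rewrite ltnS !geq_max contourS => /andP[/andP[n1 n2] /andP[n3 n4]].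
    move: (H1 _ n1) (H2 _ n2) (H3 _ n3) (H4 _ n4).
    have [-> -> -> ->] := perim_sub x y t => k1 k2 k3 k4.
    have -> : e * perim x y t ^+ 2 = e * (perim x y t / 2) ^+ 2 +
      e * (perim x y t / 2) ^+ 2 + e * (perim x y t / 2) ^+ 2 +
      e * (perim x y t / 2) ^+ 2 by field.
    apply: le_trans (cabsD _ _) (lerD _ k4).
    apply: le_trans (cabsD _ _) (lerD _ k3).
    by apply: le_trans (cabsD _ _) (lerD k1 k2).
  move=> z Kz; have e20 : 0 < e / 2 by lra.
  have [d [d0 Hd]] := iffLR (is_derive_cabsP _ _ _) (derivableP (df _ Kz)) _ e20.
  set l := 'D_1 f z in Hd.
  exists (d / 2); split=> [|x y t Kx Ky Kt xz xyt]; first lra.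
  exists 0%N => n _.
  pose h w := f w - (f z - l * z + l * w).
  have fE s r : avg n f s r = (f z - l * z + l * mid s r) + avg n h s r.
    rewrite -(avg_affine n) -avgD; apply: (eq_avg n (@midconvexT R)) => // w _.
    by rewrite /h; ring.
  have -> : contour n f x y t = contour n h x y t.
    by rewrite /contour !fE /mid; field.
  pose p := perim x y t.
  have p0 : 0 <= p by exact: perim_ge0.
  have pE : p = perim x y t by [].
  have -> : e * perim x y t ^+ 2 = p * (e / 2 * (p + p)) by rewrite -/p; field.
  apply: (contour_le n (K := [set w | cabs (w - z) <= p + p])) => //.
  - exact: midconvex_disc.
  - move=> w /= wz; rewrite /h (_ : _ - _ = f w - f z - l * (w - z)); last by ring.
    apply: le_trans (Hd _ _) _; first by move: xyt wz; rewrite -pE; lra.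
    by rewrite ler_wpM2l// ltW.
  - by move: xz; rewrite -pE /=; lra.
  - move: xz; have := cabs_triangle y z x; rewrite -pE /= pE /perim.
    by have := cabs_ge0 (t - y); have := cabs_ge0 (x - t); lra.
  - move: xz; have := cabs_triangle t z x; rewrite -pE /= pE /perim (cabsBC t x).
    by have := cabs_ge0 (t - y); have := cabs_ge0 (y - x); lra.
move=> e e0; pose p := perim a b c.
have p0 : 0 <= p by exact: perim_ge0.
have p2 : 0 < p ^+ 2 + 1 by rewrite ltr_wpDl// sqr_ge0.
have [|N HN] := key (e / (p ^+ 2 + 1)); first by rewrite divr_gt0.
exists N => n /HN; move/le_lt_trans; apply; rewrite -/p.
by rewrite mulrAC ltr_pdivrMr// ltr_pM2l//; lra.
Qed.

End Goursat.

(** * A diamond contour *)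
Section CauchyFormula.
Variable R : realType.
Local Notation C := (Cplx R).
Implicit Types (p q z w : C) (f g u : C -> C) (K : set C).

Lemma adherentI K (K' : set C) : adherent K -> adherent K' -> adherent (K `&` K').
Proof.
by move=> aK aK' z Hz; split; [apply: aK|apply: aK'] => e /Hz [w [[? ?] ?]]; exists w.
Qed.

Lemma adherent_disc z (r : R) : adherent [set w | cabs (w - z) <= r].
Proof.
move=> w Hw /=; apply/ler_addgt0Pr => e /Hw [t [/= tr tw]].
by have := cabs_triangle w z t; rewrite (cabsBC w t); lra.
Qed.

Lemma ReZ (x : R) w : complex.Re (x%:C%C * w) = x * complex.Re w.
Proof. by case: w => s t /=; rewrite mul0r subr0. Qed.

Definition half_plane z (m : C) (c : R) : set C :=
  [set w | c <= complex.Re ((w - z) * m)].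

Lemma midconvex_half_plane z (m : C) (c : R) : midconvex (half_plane z m c).
Proof.
move=> p q; rewrite /half_plane /= => hp hq.
rewrite (_ : (mid p q - z) * m =
  (2^-1 : R)%:C%C * ((p - z) * m) + (2^-1 : R)%:C%C * ((q - z) * m)); last first.
  by rewrite fmorphV rmorph_nat /mid; field.
by rewrite raddfD /= !ReZ; lra.
Qed.

Lemma adherent_half_plane z (m : C) (c : R) : adherent (half_plane z m c).
Proof.
move=> w Hw; rewrite /half_plane /=; apply/ler_addgt0Pr => e e0.
have m0 := cabs_ge0 m; have m1 : 0 < cabs m + 1 by lra.
have [|t [ht tw]] := Hw (e / (cabs m + 1)); first by rewrite divr_gt0.
have -> : (w - z) * m = (t - z) * m - (t - w) * m by ring.
rewrite raddfB /=; have := Re_le_cabs ((t - w) * m); rewrite cabsM.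
have : cabs (t - w) * cabs m <= e.
  apply: (@le_trans _ _ (e / (cabs m + 1) * (cabs m + 1))).
    by rewrite ler_pM ?cabs_ge0// ?ltW//; lra.
  by rewrite divfK// gt_eqF.
by move: ht; rewrite /half_plane /=; lra.
Qed.

Variables (a : C) (r : R).
Hypothesis r0 : 0 < r.

Definition vertex k : C := a + r%:C%C * 'i%C ^+ k.

(** The conjugate of the outer normal i^k (1 + i) to the k-th side of the diamond:
    Re ((w - a) * normal k) is, up to a factor, the height of w above the centre
    in the direction of that side. *)
Definition normal k : C := (- 'i%C) ^+ k * (1 - 'i%C).

Lemma sqr_iC : ('i%C : C) ^+ 2 = -1.
Proof. exact: sqr_i. Qed.

Lemma vertex4 : vertex 4 = vertex 0.
Proof. by rewrite /vertex (_ : 4 = 2 * 2)%N// exprM sqr_iC sqrrN !expr1n. Qed.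

Lemma cabs_i : cabs ('i%C : C) = 1.
Proof. by rewrite /cabs normc_def /= expr0n add0r expr1n sqrtr1. Qed.

Lemma cabs_normal k : cabs (normal k) <= 2.
Proof.
rewrite /normal cabsM cabsX cabsN cabs_i expr1n mul1r.
by apply: le_trans (cabsB _ _) _; rewrite cabs1 cabs_i; lra.
Qed.

Lemma iNi k : ('i%C : C) ^+ k * (- 'i%C) ^+ k = 1.
Proof. by rewrite -exprMn mulrN -expr2 sqr_iC opprK expr1n. Qed.

(** The circular segment cut off from the disc by the k-th side of the diamond.
    It contains that side, is midpoint-convex, and stays away from the centre. *)
Definition side k : set C :=
  [set w | cabs (w - a) <= r] `&` half_plane a (normal k) r.

Lemma midconvex_side k : midconvex (side k).
Proof. by apply: midconvexI; [exact: midconvex_disc|exact: midconvex_half_plane]. Qed.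

Lemma adherent_side k : adherent (side k).
Proof. by apply: adherentI; [exact: adherent_disc|exact: adherent_half_plane]. Qed.

Lemma cabs_vertex k : cabs (vertex k - a) = r.
Proof.
by rewrite /vertex [a + _]addrC addrK cabsM cabsR cabsX cabs_i expr1n mulr1 gtr0_norm.
Qed.

Lemma side_vertex k : side k (vertex k).
Proof.
split; first by rewrite /= cabs_vertex.
rewrite /half_plane /= /vertex [a + _]addrC addrK /normal.
rewrite -mulrA (mulrA ('i%C ^+ k)) iNi mul1r ReZ /=; lra.
Qed.

Lemma side_vertexS k : side k (vertex k.+1).
Proof.
split; first by rewrite /= cabs_vertex.
rewrite /half_plane /= /vertex [a + _]addrC addrK /normal.
rewrite exprSr -!mulrA (mulrCA 'i%C) (mulrA ('i%C ^+ k)) iNi mul1r ReZ /=; lra.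
Qed.

Lemma side_half_plane z k w : cabs (z - a) <= r / 4 -> side k w ->
  half_plane z (normal k) (r / 2) w.
Proof.
rewrite /half_plane /= => za [_]; rewrite /half_plane /=.
have -> : (w - z) * normal k = (w - a) * normal k - (z - a) * normal k by ring.
rewrite raddfB /=; have := Re_le_cabs ((z - a) * normal k); rewrite cabsM.
have : cabs (z - a) * cabs (normal k) <= r / 4 * 2.
  by rewrite ler_pM ?cabs_ge0// cabs_normal.
by lra.
Qed.

Lemma side_dist z k w : cabs (z - a) <= r / 4 -> side k w -> r / 4 <= cabs (w - z).
Proof.
move=> za /(side_half_plane za); rewrite /half_plane /= => h.
have := Re_le_cabs ((w - z) * normal k); rewrite cabsM.
have := cabs_ge0 (w - z); have := cabs_normal k; have := cabs_ge0 (normal k).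
by nra.
Qed.

Definition seg n f p q : C := (q - p) * avg n f p q.

(** The n-th midpoint sum for the integral of f around the diamond. *)
Definition loop n f : C := \sum_(k < 4) seg n f (vertex k) (vertex k.+1).

Lemma seg_sym n f p q : seg n f q p = - seg n f p q.
Proof. by rewrite /seg avg_sym -mulNr opprB. Qed.

Lemma loopD n f g : loop n (fun w => f w + g w) = loop n f + loop n g.
Proof. by rewrite /loop -big_split; apply: eq_bigr => k _; rewrite /seg avgD mulrDr. Qed.

Lemma loopZ n (c : C) f : loop n (fun w => c * f w) = c * loop n f.
Proof.
by rewrite /loop big_distrr; apply: eq_bigr => k _; rewrite /seg avgZ /= mulrCA.
Qed.

Lemma cabs_edge k : cabs (vertex k.+1 - vertex k) <= 2 * r.
Proof.
apply: le_trans (cabs_triangle _ _ a) _.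
by rewrite (cabsBC a) !cabs_vertex; lra.
Qed.

Lemma loop_le n f M : (forall k w, side k w -> cabs (f w) <= M) ->
  cabs (loop n f) <= 8 * r * M.
Proof.
move=> fM; have H k : cabs (seg n f (vertex k) (vertex k.+1)) <= 2 * r * M.
  rewrite cabsM ler_pM ?cabs_ge0 ?cabs_edge//.
  by apply: (avg_le _ (@midconvex_side k)) (side_vertex k) (side_vertexS k); apply: fM.
rewrite /loop !big_ord_recl big_ord0 addr0 /=.
have := H 0%N; have := H 1%N; have := H 2%N; have := H 3%N.
rewrite /bump /= !addn0 ?add1n.
set x0 := seg _ _ _ _; set x1 := seg _ _ _ _; set x2 := seg _ _ _ _; set x3 := seg _ _ _ _.
move=> h3 h2 h1 h0; have := cabsD x3 (x2 + (x1 + x0)).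
by have := cabsD x2 (x1 + x0); have := cabsD x1 x0; lra.
Qed.

End CauchyFormula.

(** * Shrinking the contour to a point *)
Section CauchyIntegral.
Variable R : realType.
Local Notation C := (Cplx R).
Implicit Types (p q z w : C) (f g u : C -> C).
Variables (a : C) (r : R).
Hypothesis r0 : 0 < r.

Local Notation vertex := (vertex a r).
Local Notation side := (side a r).
Local Notation loop := (loop a r).

Definition shrink z (s : R) p : C := z + s%:C%C * (p - z).

Definition shrunk_loop n f z s : C :=
  \sum_(k < 4) seg n f (shrink z s (vertex k)) (shrink z s (vertex k.+1)).

Lemma shrunk_loop1 n f z : shrunk_loop n f z 1 = loop n f.
Proof.
by apply: eq_bigr => k _; rewrite /shrink !mul1r !(addrC z) !subrK.
Qed.

Lemma shrink_in_disc z s p : 0 <= s <= 1 -> cabs (z - a) <= r ->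
  cabs (p - a) <= r -> cabs (shrink z s p - a) <= r.
Proof.
have r_gt0 := r0; move=> /andP[s0 s1] za pa.
have -> : shrink z s p - a = (1 - s)%:C%C * (z - a) + s%:C%C * (p - a).
  by rewrite /shrink rmorphB rmorph1; ring.
apply: le_trans (cabsD _ _) _; rewrite !cabsM !cabsR !ger0_norm ?subr_ge0//.
by nra.
Qed.

Lemma shrink_half_plane z s p (m : C) c : 0 <= s ->
  half_plane z m c p -> half_plane z m (s * c) (shrink z s p).
Proof.
rewrite /half_plane /= /shrink => s0 h.
by rewrite [z + _]addrC addrK -mulrA ReZ ler_wpM2l.
Qed.

Lemma half_planeS z (m : C) c d p : d <= c -> half_plane z m c p -> half_plane z m d p.
Proof. by move=> dc; exact: le_trans. Qed.

(** The region between two successive contours consists of four quadrilaterals,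
    one for each side, and each is the union of two triangles in a half-plane that
    excludes z.  Goursat applies to these eight triangles; the radial edges between
    neighbouring quadrilaterals cancel. *)
Lemma shrunk_loop_half f z s : 0 < s <= 1 -> cabs (z - a) <= r / 4 ->
  (forall w, cabs (w - a) <= r -> w != z -> derivable f w 1) ->
  forall e, 0 < e -> exists N, forall n, (N <= n)%N ->
    cabs (shrunk_loop n f z s - shrunk_loop n f z (s / 2)) < e.
Proof.
have r_gt0 := r0; move=> s01 za df e e0; have za' : cabs (z - a) <= r by lra.
have /andP[s0 s1] := s01.
pose Q k := shrink z s (vertex k); pose Q' k := shrink z (s / 2) (vertex k).
(* T n k is the sum over the k-th quadrilateral, cut along the diagonal from
   Q k to Q' k.+1. *)
pose T n k := contour n f (Q k) (Q k.+1) (Q' k.+1) +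
              contour n f (Q k) (Q' k.+1) (Q' k).
have TE n k : T n k = seg n f (Q k) (Q k.+1) - seg n f (Q' k) (Q' k.+1) +
    (seg n f (Q k.+1) (Q' k.+1) - seg n f (Q k) (Q' k)).
  rewrite -(seg_sym _ _ (Q' k)) -(seg_sym _ _ (Q k) (Q' k)).
  rewrite /T /contour /seg (avg_sym n f (Q k) (Q' k.+1)).
  by ring.
have HT k d : 0 < d -> exists N, forall n, (N <= n)%N -> cabs (T n k) < d.
  move=> d0; pose K := [set w | cabs (w - a) <= r] `&`
    half_plane z (normal R k) (s / 2 * (r / 2)).
  have mK : midconvex K.
    by apply: midconvexI; [exact: midconvex_disc|exact: midconvex_half_plane].
  have aK : adherent K.
    by apply: adherentI; [exact: adherent_disc|exact: adherent_half_plane].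
  have dK w : K w -> derivable f w 1.
    move=> [wa]; rewrite /half_plane /= => h; apply: df => //.
    apply/eqP => wz; move: h; rewrite wz subrr mul0r /=.
    by apply/negP; rewrite -ltNge; do 2! apply: mulr_gt0 => //; lra.
  have KQ p t : s / 2 <= t <= s -> side k p -> K (shrink z t p).
    move=> /andP[st ts] sp; split.
      by case: sp => pa _; apply: shrink_in_disc => //; apply/andP; split; lra.
    have t0 : 0 <= t by lra.
    have := shrink_half_plane t0 (side_half_plane za sp).
    by apply: half_planeS; rewrite ler_pM2r//; lra.
  have sp0 := side_vertex a r0 k; have sp1 := side_vertexS a r0 k.
  have tE1 : s / 2 <= s <= s by apply/andP; split; lra.
  have tE2 : s / 2 <= s / 2 <= s by apply/andP; split; lra.
  have d20 : 0 < d / 2 by lra.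
  have [N1 H1] := goursat aK mK dK (KQ _ _ tE1 sp0) (KQ _ _ tE1 sp1) (KQ _ _ tE2 sp1) d20.
  have [N2 H2] := goursat aK mK dK (KQ _ _ tE1 sp0) (KQ _ _ tE2 sp1) (KQ _ _ tE2 sp0) d20.
  exists (maxn N1 N2) => n; rewrite geq_max => /andP[n1 n2].
  apply: le_lt_trans (cabsD _ _) _.
  by have := H1 _ n1; have := H2 _ n2; rewrite -/(Q k) -/(Q' k); lra.
have e40 : 0 < e / 4 by lra.
have [N0 H0] := HT 0%N _ e40; have [N1 H1] := HT 1%N _ e40.
have [N2 H2] := HT 2%N _ e40; have [N3 H3] := HT 3%N _ e40.
exists (maxn (maxn N0 N1) (maxn N2 N3)) => n.
rewrite !geq_max => /andP[/andP[n0 n1] /andP[n2 n3]].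
have -> : shrunk_loop n f z s - shrunk_loop n f z (s / 2) =
    T n 0%N + (T n 1%N + (T n 2%N + T n 3%N)).
  rewrite /shrunk_loop -sumrB !big_ord_recl big_ord0 !TE /= /bump /=.
  by rewrite ?addn0 ?add1n /Q /Q' vertex4; ring.
have := cabsD (T n 0%N) (T n 1%N + (T n 2%N + T n 3%N)).
have := cabsD (T n 1%N) (T n 2%N + T n 3%N).
have := cabsD (T n 2%N) (T n 3%N).
by have := H0 _ n0; have := H1 _ n1; have := H2 _ n2; have := H3 _ n3; lra.
Qed.

Lemma shrunk_loop_exp2 f z m : cabs (z - a) <= r / 4 ->
  (forall w, cabs (w - a) <= r -> w != z -> derivable f w 1) ->
  forall e, 0 < e -> exists N, forall n, (N <= n)%N ->
    cabs (loop n f - shrunk_loop n f z (1 / 2 ^+ m)) < e.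
Proof.
move=> za df; elim: m => [|m IH] e e0.
  by exists 0%N => n _; rewrite expr0 divr1 shrunk_loop1 subrr cabs0.
have e20 : 0 < e / 2 by lra.
have [N1 H1] := IH _ e20.
have s01 : 0 < (1 / 2 ^+ m : R) <= 1.
  rewrite divr_gt0 ?exprn_gt0//= ler_pdivrMr ?exprn_gt0// mul1r.
  by apply: exprn_ege1; lra.
have [N2 H2] := shrunk_loop_half s01 za df e20.
exists (maxn N1 N2) => n; rewrite geq_max => /andP[n1 n2].
have -> : 1 / 2 ^+ m.+1 = 1 / 2 ^+ m / 2 :> R by rewrite exprS; field; rewrite expf_neq0.
have := H1 _ n1; have := H2 _ n2.
set x := shrunk_loop _ _ _ _; set y := shrunk_loop _ _ _ _ => h1 h2.
by have := cabs_triangle (loop n f) y x; lra.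
Qed.

Lemma side_neq z k w : cabs (z - a) <= r / 4 -> side k w -> w != z.
Proof.
have r_gt0 := r0; move=> za /(side_dist za) h; rewrite -subr_eq0 -cabs_gt0; lra.
Qed.

(** By homothety, the sum of f w / (w - z) on the contour shrunk by s towards z is
    the sum of f (z + s (w - z)) / (w - z) on the original contour.  For small s it
    is close to f z times the sum of 1 / (w - z), by continuity of f at z; and
    it differs from the sum for s = 1 by a quantity that tends to 0 with n. *)
Lemma cauchy_approx f z : cabs (z - a) <= r / 4 ->
  (forall w, cabs (w - a) <= r -> derivable f w 1) ->
  forall e, 0 < e -> exists N, forall n, (N <= n)%N ->
    cabs (loop n (fun w => f w / (w - z)) - f z * loop n (fun w => (w - z)^-1)) < e.
Proof.
have r_gt0 := r0; move=> za df e e0.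
have dz : derivable f z 1 by apply: df; lra.
have e10 : 0 < e / 100 by lra.
have cz : {for z, continuous f}.
  by apply: differentiable_continuous; apply/derivable1_diffP.
have [d [d0 Hd]] := iffLR (continuous_cabsP _ _) cz _ e10.
have [m Hm] := exp2_small (2 * r) d0.
have dq w : cabs (w - a) <= r -> w != z -> derivable (fun w => f w / (w - z)) w 1.
  move=> wa wz; apply: derivableM; first exact: df.
  apply: derivableV; first by rewrite subr_eq0.
  by apply: derivableB; [exact: derivable_id|exact: derivable_cst].
have e20 : 0 < e / 2 by lra.
have [N HN] := shrunk_loop_exp2 m za dq e20.
exists N => n Nn; have := HN _ Nn.
set s := 1 / 2 ^+ m; set L := loop n _; set S := shrunk_loop _ _ _ _ => h1.
have s0 : 0 < s by rewrite divr_gt0 ?exprn_gt0.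
have sC : s%:C%C != 0 :> C by rewrite (inj_eq (@complexI R) s 0) gt_eqF.
pose psi w := f (shrink z s w) / (w - z) + (- f z) * (w - z)^-1.
have E : S - f z * loop n (fun w => (w - z)^-1) = loop n psi.
  rewrite /psi loopD loopZ mulNr; congr (_ - _).
  apply: eq_bigr => k _; rewrite /seg /shrink avg_homothety.
  have -> : z + s%:C%C * (vertex k.+1 - z) - (z + s%:C%C * (vertex k - z)) =
    s%:C%C * (vertex k.+1 - vertex k) by ring.
  rewrite -mulrA mulrCA -(avgZ n s%:C%C); congr (_ * _).
  apply: (eq_avg n (@midconvex_side R a r k)); last 2 first.
  - exact: side_vertex.
  - exact: side_vertexS.
  move=> w /(side_neq za); rewrite -subr_eq0 => wz.
  by rewrite [z + _]addrC addrK /=; field; rewrite wz; exact: sC.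
have h2 : cabs (loop n psi) <= 8 * r * (e / 100 / (r / 4)).
  apply: loop_le => // k w sw.
  rewrite /psi mulNr -mulrBl cabsM cabsV.
  have wd := side_dist za sw.
  apply: ler_pM; rewrite ?invr_ge0 ?cabs_ge0//; last by rewrite lef_pV2 ?posrE; lra.
  apply/ltW/Hd; rewrite /shrink [z + _]addrC addrK cabsM cabsR gtr0_norm//.
  apply: le_lt_trans Hm; rewrite /s mul1r mulrC ler_pM2r ?invr_gt0 ?exprn_gt0//.
  case: sw => /= wa _; have := cabs_triangle w z a; rewrite (cabsBC a z); lra.
(* The contour has length at most 8 * r, and w - z has modulus at least r / 4 on
   it, which gives 32 times e / 100, below e / 2. *)
have h3 : 8 * r * (e / 100 / (r / 4)) = 32 / 100 * e by field; rewrite gt_eqF.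
move: h2; rewrite h3 -E => h2.
by have := cabs_triangle L (f z * loop n (fun w => (w - z)^-1)) S; lra.
Qed.

End CauchyIntegral.

(** * Contour integrals and Cauchy's formula *)
Section ContourIntegral.
Variable R : realType.
Local Notation C := (Cplx R).
Implicit Types (p q z w : C) (f g u : C -> C).

Lemma cvg_cabsP (s : nat -> C) (l : C) : s n @[n --> \oo] --> l <->
  (forall e : R, 0 < e -> exists N, forall n, (N <= n)%N -> cabs (s n - l) < e).
Proof.
split.
  move=> sl e e0; have /cvgrPdist_lt H := sl.
  have := H e%:C%C; rewrite (ltcR 0) => /(_ e0) [N _ HN].
  by exists N => n /HN /=; rewrite cabsE ltcR cabsBC.
move=> H; apply/cvgrPdist_lt => e e0.
have eE : e = (complex.Re e)%:C%C.
  by move: e0; case: (e) => a b; rewrite ltcE /= => /andP[/eqP-> _].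
have [|N HN] := H (complex.Re e); first by rewrite -ltcR -eE.
by exists N => // n /HN /=; rewrite eE cabsE ltcR cabsBC.
Qed.

Lemma derivable_continuous f z : derivable f z 1 -> {for z, continuous f}.
Proof. by move=> df; apply: differentiable_continuous; apply/derivable1_diffP. Qed.

Lemma conj_normal k : ((normal R k)^*%C : C) = 'i%C ^+ k * (1 + 'i%C).
Proof.
elim: k => [|k IH].
  by rewrite /normal !expr0 !mul1r; apply/eqP; rewrite eq_complex /= subr0 addr0 sub0r opprK add0r !eqxx.
have -> : normal R k.+1 = - 'i%C * normal R k by rewrite /normal exprS mulrA.
have conjM (x y : R[i]) : (x * y)^*%C = x^*%C * y^*%C by exact: rmorphM.
rewrite exprS -mulrA -IH; set x := normal R k.
transitivity ((- 'i%C : R[i])^*%C * x^*%C); first exact: conjM.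
by congr (_ * _); apply/eqP; rewrite eq_complex /= oppr0 opprK !eqxx.
Qed.

Variables (a : C) (r : R).
Hypothesis r0 : 0 < r.

Local Notation side := (side a r).
Local Notation loop := (loop a r).

(** Continuity along the contour, which makes the midpoint sums converge. *)
Definition tame f := forall k w, side k w -> {for w, continuous f}.

Definition cint f : C := lim (loop n f @[n --> \oo]).

Lemma loop_cvg f : tame f -> loop n f @[n --> \oo] --> cint f.
Proof.
move=> tf; suff [l Hl] : exists l : C, loop n f @[n --> \oo] --> l.
  by rewrite /cint (cvg_lim _ Hl).
have H k : exists l : C, avg n f (vertex a r k) (vertex a r k.+1) @[n --> \oo] --> l.
  have H := avg_cauchy (@adherent_side _ a r k) (@midconvex_side _ a r k) (tf k)
    (side_vertex a r0 k) (side_vertexS a r0 k).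
  by have [l Hl] := complex_cauchy H; exists l; apply/cvg_cabsP.
have [l Hl] := choice H.
exists (\sum_(k < 4) (vertex a r k.+1 - vertex a r k) * l k).
rewrite /loop; apply: cvg_big => [|k _]; first exact: add_continuous.
by apply: (cvgM (cvg_cst _) (Hl k)).
Qed.

Lemma tameD f g : tame f -> tame g -> tame (fun w => f w + g w).
Proof. by move=> tf tg k w sw; apply: continuousD; [exact: tf sw|exact: tg sw]. Qed.

Lemma tameM f g : tame f -> tame g -> tame (fun w => f w * g w).
Proof. by move=> tf tg k w sw; apply: continuousM; [exact: tf sw|exact: tg sw]. Qed.

Lemma tame_cst (c : C) : tame (fun=> c).
Proof. by move=> k w _; exact: cst_continuous. Qed.

Lemma tameZ (c : C) f : tame f -> tame (fun w => c * f w).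
Proof. by move=> tf; have tc := @tame_cst c; exact: (tameM tc tf). Qed.

Lemma tame_kernel z : cabs (z - a) <= r / 4 -> tame (fun w => (w - z)^-1).
Proof.
move=> za k w sw; apply: derivable_continuous; apply: derivableV.
  by rewrite subr_eq0; apply: (side_neq r0 za sw).
by apply: derivableB; [exact: derivable_id|exact: derivable_cst].
Qed.

Lemma tame_div f z : cabs (z - a) <= r / 4 -> tame f -> tame (fun w => f w / (w - z)).
Proof. by move=> za tf; exact: (tameM tf (tame_kernel za)). Qed.

Lemma cintD f g : tame f -> tame g -> cint (fun w => f w + g w) = cint f + cint g.
Proof.
move=> tf tg; apply: cvg_lim => //.
rewrite (_ : (fun n => _) = (fun n => loop n f + loop n g)); last first.
  by apply/funext => n; exact: loopD.
by apply: cvgD; exact: loop_cvg.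
Qed.

Lemma cintZ (c : C) f : tame f -> cint (fun w => c * f w) = c * cint f.
Proof.
move=> tf; apply: cvg_lim => //.
rewrite (_ : (fun n => _) = (fun n => c * loop n f)); last first.
  by apply/funext => n; exact: loopZ.
by apply: cvgM; [exact: cvg_cst|exact: loop_cvg].
Qed.

Lemma eq_cint f g : (forall k w, side k w -> f w = g w) -> cint f = cint g.
Proof.
move=> fg; rewrite /cint (_ : (fun n => loop n f) = (fun n => loop n g))//.
apply/funext => n; apply: eq_bigr => k _; rewrite /seg; congr (_ * _).
by apply: (eq_avg n (@midconvex_side _ a r k) (fg k));
  [exact: side_vertex|exact: side_vertexS].
Qed.

Lemma cint_le f M : tame f -> (forall k w, side k w -> cabs (f w) <= M) ->
  cabs (cint f) <= 8 * r * M.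
Proof.
move=> tf fM; apply/ler_addgt0Pr => e e0.
have [N HN] := iffLR (cvg_cabsP _ _) (loop_cvg tf) _ e0.
have := HN _ (leqnn N); have := loop_le r0 N fM.
have := cabsB (loop N f) (loop N f - cint f).
by rewrite opprB addrC subrK; lra.
Qed.

Lemma cauchy_formula f z : cabs (z - a) <= r / 4 ->
  (forall w, cabs (w - a) <= r -> derivable f w 1) ->
  cint (fun w => f w / (w - z)) = f z * cint (fun w => (w - z)^-1).
Proof.
move=> za df.
have tf : tame f by move=> k w [wa _]; exact/derivable_continuous/df.
have l1 := loop_cvg (tame_div za tf).
have l2 := loop_cvg (tame_kernel za).
have l3 : loop n (fun w => f w / (w - z)) - f z * loop n (fun w => (w - z)^-1)
    @[n --> \oo] --> cint (fun w => f w / (w - z)) -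
                     f z * cint (fun w => (w - z)^-1).
  exact: (cvgB l1 (cvgM (cvg_cst _) l2)).
have l4 : loop n (fun w => f w / (w - z)) - f z * loop n (fun w => (w - z)^-1)
    @[n --> \oo] --> (0 : C).
  apply/cvg_cabsP => e /(cauchy_approx r0 za df) [N HN].
  by exists N => n /HN; rewrite subr0.
by apply/eqP; rewrite -subr_eq0; apply/eqP; apply: cvg_unique l3 l4.
Qed.

(** Along each side of the diamond, (p_(k+1) - p_k) / (w - a) has imaginary part
    at least 1: the contour turns counterclockwise around a.  So the four sides
    add up to an imaginary part at least 4. *)
Lemma winding_neq0 : cint (fun w => (w - a)^-1) != 0.
Proof.
have za : cabs (a - a) <= r / 4 by rewrite subrr cabs0 divr_ge0// ltW.
have key n k :
    1 <= complex.Re (- 'i%C * seg n (fun w => (w - a)^-1) (vertex a r k) (vertex a r k.+1)).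
  pose c := vertex a r k.+1 - vertex a r k.
  have inH w : side k w -> half_plane 0 (- 'i%C * c) 1 ((w - a)^-1).
    move=> sw; rewrite /half_plane /= subr0.
    have := side_neq r0 za sw; rewrite -subr_eq0.
    case: sw; rewrite /half_plane /=; move: (w - a) => y yr ry y0.
    have -> : - 'i%C * c = r%:C%C * (normal R k)^*%C.
      rewrite conj_normal /c /vertex exprSr.
      rewrite (_ : - 'i%C * _ = r%:C%C * ('i%C ^+ k * ('i%C - 'i%C ^+ 2))); last by ring.
      by rewrite sqr_iC opprK addrC.
    rewrite mulrCA ReZ.
    have y2 : 0 < cabs y ^+ 2 by rewrite exprn_gt0// cabs_gt0.
    have -> : complex.Re (y^-1 * (normal R k)^*%C) =
        complex.Re (y * normal R k) / cabs y ^+ 2.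
      have -> : cabs y ^+ 2 = complex.Re y ^+ 2 + complex.Im y ^+ 2.
        by rewrite /cabs normc_def sqr_sqrtr// addr_ge0// sqr_ge0.
      case: (normal R k) => m1 m2; move: y2 {yr ry y0}.
      have -> : cabs y ^+ 2 = complex.Re y ^+ 2 + complex.Im y ^+ 2.
        by rewrite /cabs normc_def sqr_sqrtr// addr_ge0// sqr_ge0.
      by case: y => y1 y2 /= h; field; rewrite gt_eqF.
    rewrite mulrA ler_pdivlMr// mul1r.
    by have := cabs_ge0 y; nra.
  have := avg_in n (@midconvex_side _ a r k) (@midconvex_half_plane _ 0 (- 'i%C * c) 1)
    inH (side_vertex a r0 k) (side_vertexS a r0 k).
  by rewrite /half_plane /= subr0 /seg -/c mulrC -mulrA.
apply/eqP => c0.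
have [N /(_ N (leqnn _))] := iffLR (cvg_cabsP _ _) (loop_cvg (tame_kernel za)) 1 ltr01.
rewrite c0 subr0 => lN.
have := Re_le_cabs (- 'i%C * loop N (fun w => (w - a)^-1)).
rewrite cabsM cabsN cabs_i mul1r; move: lN; set c := cabs _.
pose S k := - 'i%C * seg N (fun w => (w - a)^-1) (vertex a r k) (vertex a r k.+1).
have -> : - 'i%C * loop N (fun w => (w - a)^-1) = S 0%N + (S 1%N + (S 2%N + S 3%N)).
  by rewrite /loop mulr_sumr !big_ord_recl big_ord0 addr0.
rewrite !raddfD /=.
have := key N 0%N; have := key N 1%N; have := key N 2%N; have := key N 3%N.
rewrite -![- _ * seg _ _ _ _]/(S _).
move: (complex.Re (S 0%N)) (complex.Re (S 1%N)) => s0 s1.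
by move: (complex.Re (S 2%N)) (complex.Re (S 3%N)) => s2 s3; lra.
Qed.

(** Differentiation under the integral sign, from a second-order estimate that is
    uniform on the contour. *)
Lemma is_derive_cint (phi : C -> C -> C) (psi : C -> C) z0 d M : 0 < d -> 0 <= M ->
  (forall z, cabs (z - z0) < d -> tame (phi z)) -> tame psi ->
  (forall z k w, cabs (z - z0) < d -> side k w ->
     cabs (phi z w - phi z0 w - (z - z0) * psi w) <= M * cabs (z - z0) ^+ 2) ->
  is_derive z0 1 (fun z => cint (phi z)) (cint psi).
Proof.
move=> d0 M0 tphi tpsi H; apply/is_derive_cabsP => e e0.
have rM : 0 < 8 * r * M + 1 by rewrite ltr_wpDl// !mulr_ge0// ltW.
exists (Order.min d (e / (8 * r * M + 1))); split=> [|z].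
  by rewrite lt_min d0 divr_gt0.
rewrite lt_min => /andP[zd ze].
have t0 : tame (phi z0) by apply: tphi; rewrite subrr cabs0.
have tz := tphi _ zd.
have t1 := @tameZ (-1) _ t0; have t2 := @tameZ (- (z - z0)) _ tpsi.
have t12 := tameD t1 t2; have t3 := tameD tz t12.
have E : cint (phi z) - cint (phi z0) - cint psi * (z - z0) =
    cint (fun w => phi z w + (-1 * phi z0 w + - (z - z0) * psi w)).
  have E1 := cintD tz t12; have E2 := cintD t1 t2.
  rewrite E1 E2 (cintZ (-1) t0) (cintZ _ tpsi); ring.
rewrite E; apply: le_trans (cint_le (M := M * cabs (z - z0) ^+ 2) t3 _) _.
- move=> k w sw; have := H z k w zd sw.
  by rewrite mulN1r mulNr addrA.
rewrite expr2 !mulrA ler_wpM2r ?cabs_ge0//.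
move: ze; rewrite ltr_pdivlMr// => ze; have := cabs_ge0 (z - z0).
by nra.
Qed.

End ContourIntegral.

(** * Cauchy transforms *)
Section LocalStructure.
Variable R : realType.
Local Notation C := (Cplx R).
Implicit Types (p q z w : C) (f g u : C -> C).

Lemma cabsM_le z w (x y : R) : cabs z <= x -> cabs w <= y -> cabs (z * w) <= x * y.
Proof. by move=> zx wy; rewrite cabsM ler_pM// cabs_ge0. Qed.

Lemma near_eq_derive1 f g z : (\forall w \near z, f w = g w) -> derive1 f z = derive1 g z.
Proof. by move=> fg; rewrite !derive1E; apply: near_eq_derive => //; exact: oner_neq0. Qed.

Lemma near_eq_derivable1 f g z : (\forall w \near z, f w = g w) ->
  derivable f z 1 -> derivable g z 1.
Proof. by move=> fg; apply: near_eq_derivable => //; exact: oner_neq0. Qed.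

Lemma derivable_div f g z : g z != 0 -> derivable f z 1 -> derivable g z 1 ->
  derivable (fun w => f w / g w) z 1.
Proof. by move=> g0 df dg; have dV := derivableV g0 dg; exact: (derivableM df dV). Qed.

Lemma derive1_div f g z : g z != 0 -> derivable f z 1 -> derivable g z 1 ->
  derive1 (fun w => f w / g w) z =
  (derive1 f z * g z - f z * derive1 g z) / g z ^+ 2.
Proof.
move=> g0 df dg; have dV := derivableV g0 dg.
rewrite !derive1E; transitivity ('D_1 (f * (fun w => (g w)^-1)) z); first by [].
rewrite (deriveM df dV) (deriveV g0 dg) /GRing.scale /=.
move: ('D_1 f z) ('D_1 g z) (f z) (g z) g0 => x y s t t0.
by rewrite expr2; field.
Qed.

Lemma derivable_near f z : holomorphic_at f z -> derivable f z 1.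
Proof. exact: nbhs_singleton. Qed.

Section Transform.
Variables (a : C) (r : R).
Hypothesis r0 : 0 < r.
Local Notation side := (side a r).
Local Notation cint := (cint a r).
Local Notation tame := (tame a r).

Lemma side_sub_neq0 z k w : cabs (z - a) <= r / 4 -> side k w -> w - z != 0.
Proof. by move=> za sw; rewrite subr_eq0; exact: (side_neq r0 za sw). Qed.

Definition cauchy_transform u z : C := cint (fun w => u w / (w - z)).

Variables (u : C -> C) (M : R).
Hypothesis tu : tame u.
Hypothesis uM : forall k w, side k w -> cabs (u w) <= M.

Lemma bound_ge0 : 0 <= M.
Proof. by apply: le_trans (cabs_ge0 _) (uM (side_vertex a r0 0)). Qed.

Lemma side_inv z k w : cabs (z - a) <= r / 4 -> side k w ->
  cabs (w - z)^-1 <= (r / 4)^-1.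
Proof.
have r_gt0 := r0; move=> za sw; have := side_dist za sw => h.
by rewrite cabsV lef_pV2 ?posrE//; lra.
Qed.

(** The regularity in z comes from the kernel alone: u only has to be continuous
    and bounded on the contour. *)
Lemma is_derive_transform z : cabs (z - a) < r / 4 ->
  is_derive z 1 (cauchy_transform u) (cauchy_transform (fun w => u w / (w - z)) z).
Proof.
have r_gt0 := r0; move=> za; have za' := ltW za; have M0 := bound_ge0.
have d0 : 0 < r / 4 - cabs (z - a) by lra.
have near_a z' : cabs (z' - z) < r / 4 - cabs (z - a) -> cabs (z' - a) <= r / 4.
  by have := cabs_triangle z' a z; lra.
have i0 : 0 <= (r / 4)^-1 by rewrite invr_ge0; lra.
have M'0 : 0 <= M * (r / 4)^-1 ^+ 3 by rewrite mulr_ge0// exprn_ge0.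
apply: (is_derive_cint r0 d0 M'0) => [z' /near_a z'a||z' k w /near_a z'a sw].
- exact: (tame_div r0 z'a tu).
- exact: (tame_div r0 za' (tame_div r0 za' tu)).
have w1 := side_sub_neq0 za' sw; have w2 := side_sub_neq0 z'a sw.
have -> : u w / (w - z') - u w / (w - z) - (z' - z) * (u w / (w - z) / (w - z)) =
  u w * ((w - z)^-1 ^+ 2 * (w - z')^-1) * (z' - z) ^+ 2 by field; rewrite w1 w2.
rewrite cabsM cabsX ler_wpM2r ?exprn_ge0 ?cabs_ge0//.
apply: (cabsM_le (uM sw)); rewrite (exprSr _ 2).
apply: cabsM_le (side_inv z'a sw); rewrite cabsX.
by apply: lerXn2r; rewrite ?nnegrE ?cabs_ge0//; exact: (side_inv za' sw).
Qed.

Lemma is_derive_transform2 z : cabs (z - a) < r / 4 ->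
  is_derive z 1 (fun z => cauchy_transform (fun w => u w / (w - z)) z)
    (cint (fun w => 2 * (u w / (w - z) / (w - z) / (w - z)))).
Proof.
have r_gt0 := r0; move=> za; have za' := ltW za; have M0 := bound_ge0.
have d0 : 0 < r / 4 - cabs (z - a) by lra.
have near_a z' : cabs (z' - z) < r / 4 - cabs (z - a) -> cabs (z' - a) <= r / 4.
  by have := cabs_triangle z' a z; lra.
have i0 : 0 <= (r / 4)^-1 by rewrite invr_ge0; lra.
have M'0 : 0 <= M * (3 * (r / 4)^-1 ^+ 4).
  by rewrite mulr_ge0// mulr_ge0// exprn_ge0.
apply: (is_derive_cint r0 d0 M'0) => [z' /near_a z'a||z' k w /near_a z'a sw].
- exact: (tame_div r0 z'a (tame_div r0 z'a tu)).
- have t3 := tame_div r0 za' (tame_div r0 za' (tame_div r0 za' tu)).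
  have t4 := @tameZ _ a r 2 _ t3; exact: t4.
have w1 := side_sub_neq0 za' sw; have w2 := side_sub_neq0 z'a sw.
have -> : u w / (w - z') / (w - z') - u w / (w - z) / (w - z) -
    (z' - z) * (2 * (u w / (w - z) / (w - z) / (w - z))) =
  u w * ((w - z)^-1 ^+ 2 * (w - z')^-1 ^+ 2 + 2 * ((w - z)^-1 ^+ 3 * (w - z')^-1))
    * (z' - z) ^+ 2 by field; rewrite w1 w2.
rewrite cabsM cabsX ler_wpM2r ?exprn_ge0 ?cabs_ge0//.
apply: (cabsM_le (uM sw)).
have h1 := side_inv za' sw; have h2 := side_inv z'a sw.
have p1 n : cabs ((w - z)^-1 ^+ n) <= (r / 4)^-1 ^+ n.
  by rewrite cabsX; apply: lerXn2r; rewrite ?nnegrE ?cabs_ge0.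
have p2 n : cabs ((w - z')^-1 ^+ n) <= (r / 4)^-1 ^+ n.
  by rewrite cabsX; apply: lerXn2r; rewrite ?nnegrE ?cabs_ge0.
have -> : 3 * (r / 4)^-1 ^+ 4 = (r / 4)^-1 ^+ 2 * (r / 4)^-1 ^+ 2 +
    2 * ((r / 4)^-1 ^+ 3 * (r / 4)^-1) by ring.
apply: le_trans (cabsD _ _) (lerD (cabsM_le (p1 2) (p2 2)) _).
by apply: cabsM_le (cabsM_le (p1 3) h2); rewrite cabs2.
Qed.

(** 1 / (w - z) = 1 / (w - a) + (z - a) / ((w - a) (w - z)). *)
Lemma transform_taylor1 z : cabs (z - a) <= r / 4 ->
  cauchy_transform u z = cauchy_transform u a +
    (z - a) * cauchy_transform (fun w => u w / (w - a)) z.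
Proof.
move=> za; have aa : cabs (a - a) <= r / 4 by rewrite subrr cabs0 divr_ge0// ltW.
have t1 := tame_div r0 aa tu; have t2 := tame_div r0 za t1.
rewrite /cauchy_transform -(cintZ r0 (z - a) t2) -(cintD r0 t1 (@tameZ _ a r (z - a) _ t2)).
apply: (eq_cint r0) => k w sw.
have w1 := side_sub_neq0 za sw; have w2 := side_sub_neq0 aa sw.
by field; rewrite w1 w2.
Qed.

Lemma transform_le z : cabs (z - a) <= r / 4 -> cabs (cauchy_transform u z) <= 32 * M.
Proof.
move=> za; have -> : 32 * M = 8 * r * (M * (r / 4)^-1) by field; rewrite gt_eqF.
apply: (cint_le r0 (tame_div r0 za tu)).
move=> k w sw; exact: (cabsM_le (uM sw) (side_inv za sw)).
Qed.

End Transform.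

End LocalStructure.

(** * Holomorphic functions: smoothness and zeros *)
Section Holomorphic.
Variable R : realType.
Local Notation C := (Cplx R).
Implicit Types (a z w : C) (f g h u : C -> C).

Lemma holomorphic_disc g a : holomorphic_at g a -> exists (r M : R),
  [/\ 0 < r, forall w, cabs (w - a) <= r -> derivable g w 1 &
      forall w, cabs (w - a) <= r -> cabs (g w) <= M].
Proof.
move=> hg; have [d [d0 Hd]] := iffLR (near_cabsP _ _) hg.
have [e [e0 He]] := iffLR (continuous_cabsP _ _)
  (derivable_continuous (derivable_near hg)) 1 ltr01.
have m0 : 0 < Order.min d e by rewrite lt_min d0.
exists (Order.min d e / 2), (cabs (g a) + 1); split; first lra.
- move=> w wa; apply: Hd; apply: (@lt_le_trans _ _ (Order.min d e)); first lra.
  by rewrite ge_min lexx.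
move=> w wa; have : cabs (g w - g a) < 1.
  apply: He; apply: (@lt_le_trans _ _ (Order.min d e)); first lra.
  by rewrite ge_min lexx orbT.
by have := cabsD (g w - g a) (g a); rewrite subrK; lra.
Qed.

Section LocalQuotient.
Variables (a : C) (r M : R) (g : C -> C).
Hypothesis r0 : 0 < r.
Hypothesis dg : forall w, cabs (w - a) <= r -> derivable g w 1.
Hypothesis gM : forall w, cabs (w - a) <= r -> cabs (g w) <= M.

Let N := cauchy_transform a r g.
Let W := cauchy_transform a r (fun=> 1).

Lemma tame_derivable : tame a r g.
Proof. by move=> k w [wa _]; apply/derivable_continuous/dg. Qed.

Lemma side_bound k w : side a r k w -> cabs (g w) <= M.
Proof. by case=> wa _; exact: gM. Qed.

Lemma is_derive_winding z : cabs (z - a) < r / 4 ->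
  is_derive z 1 W (cauchy_transform a r (fun w => 1 / (w - z)) z).
Proof.
apply: (is_derive_transform r0 (M := 1)); first exact: (@tame_cst _ a r 1).
by move=> k w _; rewrite cabs1.
Qed.

(** Cauchy's formula solved for g, where the winding integral W is nonzero: it is
    nonzero at a and continuous. *)
Lemma cauchy_quotient : exists d : R, 0 < d /\ forall z, cabs (z - a) < d ->
  [/\ cabs (z - a) < r / 4, W z != 0 & g z = N z / W z].
Proof.
have r_gt0 := r0.
have WE z : W z = cint a r (fun w => (w - z)^-1).
  by apply: (eq_cint r0) => k w _; rewrite mul1r.
have aa : cabs (a - a) < r / 4 by rewrite subrr cabs0 divr_gt0.
have [dW _] := is_derive_winding aa.
have W0 : 0 < cabs (W a) by rewrite cabs_gt0 WE winding_neq0.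
have [d [d0 Hd]] := iffLR (continuous_cabsP _ _) (derivable_continuous dW) _ W0.
exists (Order.min d (r / 4)); split=> [|z]; first by rewrite lt_min d0 divr_gt0.
rewrite lt_min => /andP[zd zr].
have Wz : W z != 0.
  apply/eqP => Wz; have := Hd _ zd; rewrite Wz sub0r cabsN; lra.
split=> //; rewrite /N /cauchy_transform (cauchy_formula r0 (ltW zr) dg).
by rewrite -WE mulfK.
Qed.

End LocalQuotient.

Lemma near_disc a (d : R) : 0 < d -> \forall z \near a, cabs (z - a) < d.
Proof. by move=> d0; apply/near_cabsP; exists d. Qed.

(** Near a, g is a quotient of two Cauchy transforms, and these are twice
    differentiable. *)
Lemma holomorphic_derive1 g a : holomorphic_at g a -> holomorphic_at (derive1 g) a.
Proof.
move=> /holomorphic_disc [r [M [r0 dg gM]]].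
have [d [d0 Hd]] := cauchy_quotient r0 dg.
have tg := tame_derivable dg; have gM' k w := side_bound gM (k := k) (w := w).
have t1 := @tame_cst _ a r 1.
have M1 k w : side a r k w -> cabs ((fun=> 1 : C) w) <= 1 by rewrite cabs1.
pose T u := cauchy_transform a r u.
pose T2 u z := T (fun w => u w / (w - z)) z.
pose q z := (T2 g z * T (fun=> 1) z - T g z * T2 (fun=> 1) z) / T (fun=> 1) z ^+ 2.
have near_d z : cabs (z - a) < d -> \forall w \near z, cabs (w - a) < d.
  move=> zd; apply/near_cabsP; exists (d - cabs (z - a)); split; first by rewrite subr_gt0.
  by move=> w; have := cabs_triangle w a z; lra.
have dq z : cabs (z - a) < d -> derive1 g z = q z.
  move=> zd; have [zr Wz _] := Hd z zd.
  have [dN eN] := is_derive_transform r0 tg gM' zr.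
  have [dW eW] := is_derive_transform r0 t1 M1 zr.
  rewrite (@near_eq_derive1 _ _ (fun z => T g z / T (fun=> 1) z)).
    rewrite (derive1_div Wz dN dW) !derive1E.
    by congr ((_ * _ - _ * _) / _); [exact: eN|exact: eW].
  by apply: filterS (near_d z zd) => w /Hd [].
rewrite /holomorphic_at; apply: filterS (near_disc a d0) => z zd.
apply: (@near_eq_derivable1 _ q).
  by apply: filterS (near_d z zd) => w wd; rewrite dq.
have [zr Wz _] := Hd z zd.
have [dN _] := is_derive_transform r0 tg gM' zr.
have [dW _] := is_derive_transform r0 t1 M1 zr.
have [dN2 _] := is_derive_transform2 r0 tg gM' zr.
have [dW2 _] := is_derive_transform2 r0 t1 M1 zr.
apply: derivable_div; first by rewrite expf_neq0.
  exact: (derivableB (derivableM dN2 dW) (derivableM dN dW2)).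
exact: (derivableM dW dW).
Qed.

(** Iterating transform_taylor1 produces the Taylor coefficients T n a of the
    transform of g.  If T m a is the first nonzero one, the transform is (z - a) ^ m
    times T m.  If they all vanish, the transform is (z - a) ^ n * T n z for every
    n; as T n z grows at most like (4 / r) ^ n, it is 0 for |z - a| < r / 8. *)
Lemma holomorphic_zero_order g a : holomorphic_at g a ->
  (\forall z \near a, g z = 0) \/
  exists (m : nat) (h : C -> C), [/\ holomorphic_at h a, h a != 0 &
    \forall z \near a, g z = (z - a) ^+ m * h z].
Proof.
move=> /holomorphic_disc [r [M [r0 dg gM]]].
have [d [d0 Hd]] := cauchy_quotient r0 dg.
have aa : cabs (a - a) < r / 4 by rewrite subrr cabs0 divr_gt0.
pose un n := iter n (fun (u : C -> C) w => u w / (w - a)) g.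
pose T n := cauchy_transform a r (un n).
pose W := cauchy_transform a r (fun=> 1).
have tu n : tame a r (un n).
  elim: n => [|n IH]; first exact: tame_derivable.
  exact: (tame_div r0 (ltW aa) IH).
have uM n k w : side a r k w -> cabs (un n w) <= M * (r / 4)^-1 ^+ n.
  move=> sw; elim: n => [|n IH]; first by rewrite mulr1; exact: side_bound sw.
  by rewrite exprSr mulrA; exact: (cabsM_le IH (side_inv r0 (ltW aa) sw)).
have taylor n z : cabs (z - a) < r / 4 -> T n z = T n a + (z - a) * T n.+1 z.
  by move=> /ltW zr; exact: (transform_taylor1 r0 (tu n) zr).
have factor n z : (forall i, (i < n)%N -> T i a = 0) -> cabs (z - a) < r / 4 ->
    T 0%N z = (z - a) ^+ n * T n z.
  move=> Ti zr; elim: n Ti => [|n IH] Ti; first by rewrite mul1r.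
  rewrite IH => [|i ilt]; last by apply: Ti; exact: ltnW.
  by rewrite taylor// Ti// add0r exprSr mulrA.
have [Tall|] := pselect (forall n, T n a = 0).
  left; apply: filterS2 (near_disc a d0) (near_disc a (divr_gt0 r0 (_ : 0 < 8))) => //.
  move=> z zd z8; have [zr Wz ->] := Hd z zd.
  suff T0 : T 0%N z = 0 by rewrite -[cauchy_transform a r g z]/(T 0%N z) T0 mul0r.
  have M0 := bound_ge0 r0 (fun k w => @side_bound a r M g gM k w).
  have le n : cabs (T 0%N z) <= 32 * M / 2 ^+ n.
    rewrite (factor n)//; apply: (@le_trans _ _ ((r / 8) ^+ n * (32 * (M * (r / 4)^-1 ^+ n)))).
      apply: cabsM_le; last exact: (transform_le r0 (tu n) (uM n) (ltW zr)).
      rewrite cabsX; apply: lerXn2r; rewrite ?nnegrE ?cabs_ge0// ?ltW//.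
      by rewrite divr_gt0.
    rewrite (_ : (r / 8) ^+ n * _ = 32 * M * ((r / 8) * (r / 4)^-1) ^+ n); last first.
      by rewrite [in RHS]exprMn; move: ((r / 8) ^+ n) ((r / 4)^-1 ^+ n) => x y; ring.
    rewrite (_ : r / 8 * (r / 4)^-1 = 2^-1); last by field; rewrite gt_eqF.
    by rewrite exprVn.
  apply/eqP; rewrite -cabs_eq0 eq_le cabs_ge0 andbT; apply/ler_addgt0Pr => e e0.
  have [n Hn] := exp2_small (32 * M) e0.
  by rewrite add0r; apply: le_trans (le n) (ltW Hn).
move=> /existsNP [n0 Tn0].
have exT : exists n, T n a != 0 by exists n0; apply/eqP.
case: (ex_minnP exT) => m Tm mmin.
right; exists m, (fun z => T m z / W z).
have Wa : W a != 0 by have [|_ + _] := Hd a; rewrite ?subrr ?cabs0.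
have t1 := @tame_cst _ a r 1.
have M1 k w : side a r k w -> cabs ((fun=> 1 : C) w) <= 1 by rewrite cabs1.
split.
- apply: filterS (near_disc a d0) => z zd; have [zr Wz _] := Hd z zd.
  have [dT _] := is_derive_transform r0 (tu m) (uM m) zr.
  have [dW _] := is_derive_transform r0 t1 M1 zr.
  exact: (derivable_div Wz dT dW).
- by rewrite mulf_neq0// invr_eq0.
apply: filterS (near_disc a d0) => z zd; have [zr Wz ->] := Hd z zd.
rewrite -[cauchy_transform a r g z]/(T 0%N z) (factor m)// ?mulrA//.
move=> i im; apply/eqP; apply: contraTT im => Ti.
by rewrite -leqNgt; exact: mmin.
Qed.

End Holomorphic.

(** * Meromorphic functions *)
Section MeromorphicCalculus.
Variable R : realType.
Local Notation C := (Cplx R).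
Implicit Types (a z w : C) (f g h u : C -> C).

Lemma near_dnbhsW a (P : set C) : (\forall z \near a, P z) -> \forall z \near a^', P z.
Proof.
by move=> /near_cabsP [d [d0 Hd]]; apply/near_dnbhs_cabsP; exists d; split=> // w /Hd.
Qed.

(** Punctured neighbourhoods are open, so what holds on one also holds near each of
    its points; derivatives may thus be taken of identities valid off a discrete
    set. *)
Lemma near_dnbhs_nbhs a (P : set C) : (\forall z \near a^', P z) ->
  \forall z \near a^', \forall w \near z, P w.
Proof.
move=> /near_dnbhs_cabsP [d [d0 Hd]]; apply/near_dnbhs_cabsP; exists d; split=> // z zd za.
have az : 0 < cabs (z - a) by rewrite cabs_gt0 subr_eq0.
apply/near_cabsP; exists (Order.min (d - cabs (z - a)) (cabs (z - a))).
split=> [|w]; first by rewrite lt_min az subr_gt0 zd.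
rewrite lt_min => /andP[w1 w2]; apply: Hd.
  by have := cabs_triangle w a z; lra.
by apply: contraTneq w2 => ->; rewrite cabsBC ltxx.
Qed.

Lemma near_dnbhs_neq a : \forall z \near a^', z != a.
Proof. by apply/near_dnbhs_cabsP; exists 1. Qed.

Lemma not_near_dnbhs a (P : set C) : (\forall z \near a^', P z) ->
  (\forall z \near a^', ~ P z) -> False.
Proof.
move=> h1 h2; have [z] : exists z : C, P z /\ ~ P z; last by case.
exact: (@filter_ex _ (a^') (Proper_dnbhs_numFieldType a) _ (filterI h1 h2)).
Qed.

Lemma eqfun_meq f g : f =1 g -> meq f g.
Proof. by move=> fg a; apply: nearW. Qed.

Lemma meq_refl f : meq f f. Proof. exact: eqfun_meq. Qed.

Lemma meq_sym f g : meq f g -> meq g f.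
Proof. by move=> fg a; apply: filterS (fg a) => z ->. Qed.

Lemma meq_trans g f h : meq f g -> meq g h -> meq f h.
Proof. by move=> fg gh a; apply: filterS2 (fg a) (gh a) => z -> ->. Qed.

Lemma meqD f f' g g' : meq f f' -> meq g g' ->
  meq (fun z => f z + g z) (fun z => f' z + g' z).
Proof. by move=> h1 h2 a; apply: filterS2 (h1 a) (h2 a) => z -> ->. Qed.

Lemma meqM f f' g g' : meq f f' -> meq g g' ->
  meq (fun z => f z * g z) (fun z => f' z * g' z).
Proof. by move=> h1 h2 a; apply: filterS2 (h1 a) (h2 a) => z -> ->. Qed.

Lemma meqN f f' : meq f f' -> meq (fun z => - f z) (fun z => - f' z).
Proof. by move=> h1 a; apply: filterS (h1 a) => z ->. Qed.

Lemma meqV f f' : meq f f' -> meq (fun z => (f z)^-1) (fun z => (f' z)^-1).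
Proof. by move=> h1 a; apply: filterS (h1 a) => z ->. Qed.

Lemma meq_derive1 f f' : meq f f' -> meq (derive1 f) (derive1 f').
Proof.
move=> ff a; apply: filterS (near_dnbhs_nbhs (ff a)) => z.
exact: near_eq_derive1.
Qed.

Lemma holomorphic_cst (c : C) a : holomorphic_at (fun=> c) a.
Proof. by apply: filterS (near_disc a ltr01) => z _; exact: derivable_cst. Qed.

Lemma holomorphicD f g a : holomorphic_at f a -> holomorphic_at g a ->
  holomorphic_at (fun z => f z + g z) a.
Proof. by move=> hf hg; apply: filterS2 hf hg => z df dg; exact: (derivableD df dg). Qed.

Lemma holomorphicM f g a : holomorphic_at f a -> holomorphic_at g a ->
  holomorphic_at (fun z => f z * g z) a.
Proof. by move=> hf hg; apply: filterS2 hf hg => z df dg; exact: (derivableM df dg). Qed.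

Lemma holomorphic_powB n a b : holomorphic_at (fun z : C => (z - b) ^+ n) a.
Proof.
elim: n => [|n IH]; first by under eq_fun do rewrite expr0; exact: holomorphic_cst.
under eq_fun do rewrite exprS; apply: holomorphicM IH.
by apply: filterS (near_disc a ltr01) => z _;
  apply: derivableB; [exact: derivable_id|exact: derivable_cst].
Qed.

Lemma holomorphicV f a : holomorphic_at f a -> f a != 0 ->
  holomorphic_at (fun z => (f z)^-1) a.
Proof.
move=> hf fa; have fa0 : 0 < cabs (f a) by rewrite cabs_gt0.
have [d [d0 Hd]] := iffLR (continuous_cabsP _ _)
  (derivable_continuous (derivable_near hf)) _ fa0.
apply: filterS2 hf (near_disc a d0) => z df zd; apply: derivableV => //.
by apply/eqP => fz; have := Hd _ zd; rewrite fz sub0r cabsN ltxx.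
Qed.

Lemma near_neq0 f a : holomorphic_at f a -> f a != 0 -> \forall z \near a, f z != 0.
Proof.
move=> hf fa; have fa0 : 0 < cabs (f a) by rewrite cabs_gt0.
have [d [d0 Hd]] := iffLR (continuous_cabsP _ _)
  (derivable_continuous (derivable_near hf)) _ fa0.
apply: filterS (near_disc a d0) => z zd.
by apply/eqP => fz; have := Hd _ zd; rewrite fz sub0r cabsN ltxx.
Qed.

Lemma meromorphic_quotient f a : meromorphic f -> exists (m : nat) g,
  holomorphic_at g a /\ \forall z \near a^', f z = g z / (z - a) ^+ m.
Proof.
move=> /(_ a) [m [g [hg fg]]]; exists m, g; split=> //.
apply: filterS2 fg (near_dnbhs_neq a) => z <- za.
by rewrite mulrC mulKf// expf_neq0// subr_eq0.
Qed.

Lemma meq_meromorphic f g : meq f g -> meromorphic f -> meromorphic g.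
Proof.
move=> fg mf a; have [m [h [hh fh]]] := mf a; exists m, h; split=> //.
by apply: filterS2 fh (fg a) => z <- ->.
Qed.

Lemma meromorphic_cst (c : C) : meromorphic (fun=> c).
Proof.
move=> a; exists 0%N, (fun=> c); split; first exact: holomorphic_cst.
by apply: nearW => z; rewrite mul1r.
Qed.

Lemma meromorphicD f g : meromorphic f -> meromorphic g ->
  meromorphic (fun z => f z + g z).
Proof.
move=> mf mg a; have [m [u [hu fu]]] := mf a; have [n [v [hv gv]]] := mg a.
exists (m + n)%N, (fun z => (z - a) ^+ n * u z + (z - a) ^+ m * v z); split.
  have hp k := holomorphic_powB k a a.
  exact: (holomorphicD (holomorphicM (hp n) hu) (holomorphicM (hp m) hv)).
by apply: filterS2 fu gv => z <- <-; rewrite exprD; ring.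
Qed.

Lemma meromorphicM f g : meromorphic f -> meromorphic g ->
  meromorphic (fun z => f z * g z).
Proof.
move=> mf mg a; have [m [u [hu fu]]] := mf a; have [n [v [hv gv]]] := mg a.
exists (m + n)%N, (fun z => u z * v z); split; first exact: (holomorphicM hu hv).
by apply: filterS2 fu gv => z <- <-; rewrite exprD; ring.
Qed.

Lemma meromorphicN f : meromorphic f -> meromorphic (fun z => - f z).
Proof.
move=> mf; have := meromorphicM (meromorphic_cst (-1)) mf.
by apply: meq_meromorphic; apply: eqfun_meq => z; rewrite mulN1r.
Qed.

Lemma meromorphic_derivable f a : meromorphic f -> \forall z \near a^', derivable f z 1.
Proof.
move=> /(meromorphic_quotient a) [m [g [hg fg]]].
apply: filterS3 (near_dnbhs_nbhs fg) (near_dnbhsW hg) (near_dnbhs_neq a).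
move=> z fgz dg za.
apply: (@near_eq_derivable1 _ (fun z => g z / (z - a) ^+ m)).
  by apply: filterS fgz => w; exact: esym.
have p0 : (z - a) ^+ m != 0 by rewrite expf_neq0// subr_eq0.
have dp : derivable (fun w => (w - a) ^+ m) z 1.
  exact: (derivable_near (holomorphic_powB m z a)).
exact: (derivable_div (g := fun w => (w - a) ^+ m) p0 dg dp).
Qed.

Lemma derive1_powB n z a : derive1 (fun w : C => (w - a) ^+ n) z = n%:R * (z - a) ^+ n.-1.
Proof.
have dB : is_derive z 1 (fun w : C => w - a) (1 - 0).
  exact: (is_deriveB (is_derive_id _ _) (is_derive_cst _ _ _)).
have := is_deriveX n dB; move=> [_ E]; rewrite derive1E.
rewrite (_ : (fun w => (w - a) ^+ n) = (fun w : C => w - a) ^+ n).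
  by rewrite E /GRing.scale /= subr0 mulr1.
by rewrite exprfctE.
Qed.

Lemma meromorphic_derive1 f : meromorphic f -> meromorphic (derive1 f).
Proof.
move=> mf a; have [m [g [hg fg]]] := meromorphic_quotient a mf.
exists m.+1, (fun z => (z - a) ^+ 1 * derive1 g z + (- m%:R) * g z); split.
  exact: (holomorphicD (holomorphicM (holomorphic_powB 1 a a) (holomorphic_derive1 hg))
    (holomorphicM (holomorphic_cst (- m%:R) a) hg)).
apply: filterS3 (near_dnbhs_nbhs fg) (near_dnbhsW hg) (near_dnbhs_neq a).
move=> z fgz dg za; rewrite (near_eq_derive1 fgz).
have z0 : z - a != 0 by rewrite subr_eq0.
have p0 : (z - a) ^+ m != 0 by rewrite expf_neq0.
rewrite (derive1_div (g := fun w => (w - a) ^+ m) p0 dg (derivable_near (holomorphic_powB m z a))).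
rewrite derive1_powB expr1.
case: m {fg fgz p0} => [|m] /=; first by rewrite expr1 expr0 !mul0r; field.
rewrite !exprS; field.
by rewrite z0 expf_neq0.
Qed.

(** The identity theorem.  The set of points around which f vanishes is open, and
    holomorphic_zero_order shows that its complement is open too. *)
Lemma meromorphic_zero f : meromorphic f ->
  meq f (fun=> 0) \/ forall a, \forall z \near a^', f z != 0.
Proof.
move=> mf.
have dich a : (\forall z \near a^', f z = 0) \/ (\forall z \near a^', f z != 0).
  have [m [g [hg fg]]] := meromorphic_quotient a mf.
  have [g0|[n [h [hh ha gh]]]] := holomorphic_zero_order hg.
    by left; apply: filterS2 fg (near_dnbhsW g0) => z -> ->; rewrite mul0r.
  right; apply: filterS3 (filterI fg (near_dnbhs_neq a)) (near_dnbhsW gh)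
    (near_dnbhsW (near_neq0 hh ha)) => z [-> za] -> hz.
  by rewrite !mulf_neq0 ?invr_eq0 ?expf_neq0// subr_eq0.
pose Z a := \forall z \near a^', f z = 0.
have [[a Za]|noZ] := pselect (exists a, Z a).
  left=> b; apply: (@clopen_total _ Z _ a b Za) => z.
  have up (P : set C) : P z -> (\forall w \near z^', P w) -> \forall w \near z, P w.
    move=> Pz /near_dnbhs_cabsP [d [d0 Hd]]; apply/near_cabsP; exists d; split=> // w wd.
    by have [->|/(Hd _ wd)] := eqVneq w z.
  have [z0|zn0] := dich z.
    left; apply: up => //; apply: filterS (near_dnbhs_nbhs z0) => w; exact: near_dnbhsW.
  have nZ w : (\forall t \near w^', f t != 0) -> ~ Z w.
    move=> wn0 Zw; apply: (not_near_dnbhs Zw).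
    by apply: filterS wn0 => t /eqP.
  right; apply: up; first exact: nZ.
  by apply: filterS (near_dnbhs_nbhs zn0) => w /near_dnbhsW; exact: nZ.
right=> a; have [Za|//] := dich a.
by case: noZ; exists a.
Qed.

Lemma meromorphicV f : meromorphic f -> meromorphic (fun z => (f z)^-1).
Proof.
move=> mf; have [f0|fn0] := meromorphic_zero mf.
  apply: meq_meromorphic (meromorphic_cst 0).
  by move=> a; apply: filterS (f0 a) => z ->; rewrite invr0.
move=> a; have [m [g [hg fg]]] := meromorphic_quotient a mf.
have [g0|[n [h [hh ha gh]]]] := holomorphic_zero_order hg.
  exfalso; apply: (@not_near_dnbhs a (fun z => f z = 0)).
    by apply: filterS2 fg (near_dnbhsW g0) => z -> ->; rewrite mul0r.
  by apply: filterS (fn0 a) => z /eqP.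
exists n, (fun z => (z - a) ^+ m * (h z)^-1); split.
  exact: (holomorphicM (holomorphic_powB m a a) (holomorphicV hh ha)).
apply: filterS3 (filterI fg (near_dnbhs_neq a)) (near_dnbhsW gh)
    (near_dnbhsW (near_neq0 hh ha)) => z [-> za] -> hz.
have z0 : z - a != 0 by rewrite subr_eq0.
by field; rewrite hz !expf_neq0.
Qed.

End MeromorphicCalculus.

(** * The differential field of meromorphic functions *)
Section MeromorphicField.
Variable R : realType.
Local Notation C := (Cplx R).
Implicit Types (f g : C -> C).

Lemma meq_class_inhabited f : exists g, meq f g.
Proof. by exists f; exact: meq_refl. Qed.

(** A representative that depends on the class of f modulo meq only, so that
    classes can be compared by Leibniz equality. *)
Definition canon f : C -> C := sval (cid (meq_class_inhabited f)).

Lemma canonP f : meq f (canon f).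
Proof. exact: svalP (cid (meq_class_inhabited f)). Qed.

Lemma eq_canon f g : meq f g -> canon f = canon g.
Proof.
move=> fg; have E : meq f = meq g.
  apply/funext => h; apply/propext; split; first exact: meq_trans (meq_sym fg).
  exact: meq_trans fg.
rewrite /canon; move: (meq_class_inhabited f) (meq_class_inhabited g).
by rewrite E => h1 h2; congr (sval (cid _)); exact: Prop_irrelevance.
Qed.

Record mero : Type := Mero {
  rep : C -> C;
  rep_mero : meromorphic rep;
  rep_canon : canon rep = rep }.

Implicit Types x y : mero.

Lemma eq_mero x y : meq (rep x) (rep y) -> x = y.
Proof.
move=> /eq_canon; rewrite !rep_canon; case: x => f mf cf; case: y => g mg cg /= fg.
case: _ / fg in mg cg *; congr Mero; exact: Prop_irrelevance.
Qed.

Lemma canon_mero f : meromorphic f -> meromorphic (canon f).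
Proof. exact: meq_meromorphic (canonP f). Qed.

Lemma canonK f : canon (canon f) = canon f.
Proof. exact/esym/eq_canon/canonP. Qed.

Definition cls f (mf : meromorphic f) : mero := Mero (canon_mero mf) (canonK f).

Lemma rep_cls f (mf : meromorphic f) : meq (rep (cls mf)) f.
Proof. exact/meq_sym/canonP. Qed.

Lemma eq_cls f g (mf : meromorphic f) (mg : meromorphic g) :
  cls mf = cls mg <-> meq f g.
Proof.
split=> [E|fg].
  by apply: meq_trans (meq_sym (rep_cls mf)) _; rewrite E; exact: rep_cls.
apply: eq_mero; apply: meq_trans (rep_cls mf) _.
exact: meq_trans fg (meq_sym (rep_cls mg)).
Qed.

Lemma eqfun_cls f g (mf : meromorphic f) (mg : meromorphic g) :
  f =1 g -> cls mf = cls mg.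
Proof. by move=> fg; apply/eq_cls/eqfun_meq. Qed.

Lemma clsP x : exists f (mf : meromorphic f), x = cls mf.
Proof.
by exists (rep x), (rep_mero x); apply: eq_mero; apply/meq_sym/rep_cls.
Qed.

Definition mero_cst (c : C) := cls (meromorphic_cst c).
Definition mero_add x y := cls (meromorphicD (rep_mero x) (rep_mero y)).
Definition mero_opp x := cls (meromorphicN (rep_mero x)).
Definition mero_mul x y := cls (meromorphicM (rep_mero x) (rep_mero y)).
Definition mero_inv x := cls (meromorphicV (rep_mero x)).
Definition mero_der x := cls (meromorphic_derive1 (rep_mero x)).

Lemma cls_add f g (mf : meromorphic f) (mg : meromorphic g) :
  mero_add (cls mf) (cls mg) = cls (meromorphicD mf mg).
Proof. by apply/eq_cls; apply: meqD; exact: rep_cls. Qed.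

Lemma cls_mul f g (mf : meromorphic f) (mg : meromorphic g) :
  mero_mul (cls mf) (cls mg) = cls (meromorphicM mf mg).
Proof. by apply/eq_cls; apply: meqM; exact: rep_cls. Qed.

Lemma cls_opp f (mf : meromorphic f) : mero_opp (cls mf) = cls (meromorphicN mf).
Proof. by apply/eq_cls; apply: meqN; exact: rep_cls. Qed.

Lemma cls_inv f (mf : meromorphic f) : mero_inv (cls mf) = cls (meromorphicV mf).
Proof. by apply/eq_cls; apply: meqV; exact: rep_cls. Qed.

Lemma cls_der f (mf : meromorphic f) : mero_der (cls mf) = cls (meromorphic_derive1 mf).
Proof. by apply/eq_cls; apply: meq_derive1; exact: rep_cls. Qed.

HB.instance Definition _ := gen_eqMixin mero.
HB.instance Definition _ := gen_choiceMixin mero.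

Fact mero_addA : associative mero_add.
Proof.
move=> x y z; have [f [mf ->]] := clsP x; have [g [mg ->]] := clsP y.
have [h [mh ->]] := clsP z; rewrite !cls_add; apply: eqfun_cls => w.
exact: addrA.
Qed.

Fact mero_addC : commutative mero_add.
Proof.
move=> x y; have [f [mf ->]] := clsP x; have [g [mg ->]] := clsP y.
by rewrite !cls_add; apply: eqfun_cls => w; exact: addrC.
Qed.

Fact mero_add0 : left_id (mero_cst 0) mero_add.
Proof.
move=> x; have [f [mf ->]] := clsP x.
by rewrite !cls_add; apply: eqfun_cls => w; exact: add0r.
Qed.

Fact mero_addN : left_inverse (mero_cst 0) mero_opp mero_add.
Proof.
move=> x; have [f [mf ->]] := clsP x.
by rewrite cls_opp cls_add; apply: eqfun_cls => w; exact: addNr.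
Qed.

HB.instance Definition _ :=
  GRing.isZmodule.Build mero mero_addA mero_addC mero_add0 mero_addN.

Fact mero_mulA : associative mero_mul.
Proof.
move=> x y z; have [f [mf ->]] := clsP x; have [g [mg ->]] := clsP y.
have [h [mh ->]] := clsP z; rewrite !cls_mul; apply: eqfun_cls => w.
exact: mulrA.
Qed.

Fact mero_mulC : commutative mero_mul.
Proof.
move=> x y; have [f [mf ->]] := clsP x; have [g [mg ->]] := clsP y.
by rewrite !cls_mul; apply: eqfun_cls => w; exact: mulrC.
Qed.

Fact mero_mul1 : left_id (mero_cst 1) mero_mul.
Proof.
move=> x; have [f [mf ->]] := clsP x.
by rewrite !cls_mul; apply: eqfun_cls => w; exact: mul1r.
Qed.

Fact mero_mulD : left_distributive mero_mul mero_add.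
Proof.
move=> x y z; have [f [mf ->]] := clsP x; have [g [mg ->]] := clsP y.
have [h [mh ->]] := clsP z; rewrite !(cls_mul, cls_add); apply: eqfun_cls => w.
exact: mulrDl.
Qed.

Lemma mero_cst_inj : injective mero_cst.
Proof.
move=> c d /eq_cls/(_ 0) cd; apply: contrapT => ncd.
by apply: (not_near_dnbhs cd); exact: nearW.
Qed.

Fact mero_1neq0 : mero_cst 1 != mero_cst 0.
Proof. by apply/eqP => /mero_cst_inj/eqP; rewrite oner_eq0. Qed.

HB.instance Definition _ := GRing.Zmodule_isComNzRing.Build mero
  mero_mulA mero_mulC mero_mul1 mero_mulD mero_1neq0.

Fact mero_mulV x : x != 0 -> mero_mul (mero_inv x) x = mero_cst 1.
Proof.
have [f [mf ->]] := clsP x => f0; rewrite cls_inv cls_mul; apply/eq_cls.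
have [fz|fn0] := meromorphic_zero mf.
  by move: f0; rewrite (_ : cls mf = 0) ?eqxx//; apply/eq_cls.
by move=> a; apply: filterS (fn0 a) => z fz; rewrite mulVf.
Qed.

Fact mero_inv0 : mero_inv 0 = 0.
Proof. by rewrite [LHS]cls_inv; apply: eqfun_cls => z; rewrite invr0. Qed.

HB.instance Definition _ := GRing.ComNzRing_isField.Build mero mero_mulV mero_inv0.

Fact mero_cst_is_zmod_morphism : zmod_morphism mero_cst.
Proof.
move=> c d; rewrite -[RHS]/(mero_add (mero_cst c) (mero_opp (mero_cst d))).
by rewrite cls_opp cls_add; apply: eqfun_cls.
Qed.

Fact mero_cst_is_monoid_morphism : monoid_morphism mero_cst.
Proof.
split=> // c d; rewrite -[RHS]/(mero_mul (mero_cst c) (mero_cst d)).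
by rewrite cls_mul; apply: eqfun_cls.
Qed.

HB.instance Definition _ :=
  GRing.isZmodMorphism.Build C mero mero_cst mero_cst_is_zmod_morphism.
HB.instance Definition _ :=
  GRing.isMonoidMorphism.Build C mero mero_cst mero_cst_is_monoid_morphism.

Fact mero_derD : {morph mero_der : x y / x + y}.
Proof.
move=> x y; have [f [mf ->]] := clsP x; have [g [mg ->]] := clsP y.
rewrite -[cls mf + cls mg]/(mero_add (cls mf) (cls mg)).
rewrite -[RHS]/(mero_add (mero_der (cls mf)) (mero_der (cls mg))).
rewrite !(cls_add, cls_der); apply/eq_cls => a.
apply: filterS2 (meromorphic_derivable a mf) (meromorphic_derivable a mg) => z df dg.
by rewrite !derive1E; exact: (deriveD df dg).
Qed.

Fact mero_derM x y : mero_der (x * y) = mero_der x * y + x * mero_der y.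
Proof.
have [f [mf ->]] := clsP x; have [g [mg ->]] := clsP y.
rewrite -[cls mf * cls mg]/(mero_mul (cls mf) (cls mg)).
rewrite -[RHS]/(mero_add (mero_mul (mero_der (cls mf)) (cls mg))
  (mero_mul (cls mf) (mero_der (cls mg)))).
rewrite !(cls_add, cls_mul, cls_der); apply/eq_cls => a.
apply: filterS2 (meromorphic_derivable a mf) (meromorphic_derivable a mg) => z df dg.
rewrite !derive1E; transitivity ('D_1 (f * g) z); first by [].
by rewrite (deriveM df dg) addrC [_ *: _]mulrC.
Qed.

Fact mero_der_cst c : mero_der (mero_cst c) = 0.
Proof.
rewrite cls_der; apply: eqfun_cls => z; rewrite derive1E; exact: derive_cst.
Qed.

Lemma mero_natr_neq0 n : n.+1%:R != 0 :> mero.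
Proof.
rewrite -(rmorph_nat mero_cst) -(rmorph0 mero_cst) (inj_eq mero_cst_inj).
by rewrite pnatr_eq0.
Qed.

End MeromorphicField.

(** * Expanding a determinant in principal minors *)
Section MinorExpansion.

Lemma det_mxsub_inj (K : comNzRingType) m n (e : m = n) (h : 'I_m -> 'I_n)
  (M : 'M[K]_n) : injective h -> \det (mxsub h h M) = \det M.
Proof.
case: _ / e in h M * => hI.
have -> : mxsub h h M = row_perm (perm hI) (col_perm (perm hI) M).
  by apply/matrixP => i j; rewrite !mxE !permE.
rewrite row_permE col_permE !det_mulmx !det_perm mulrCA.
by rewrite -signr_addb odd_permV addbb mulr1.
Qed.

Variables (K : comNzRingType) (n : nat).
Implicit Types (M N : 'M[K]_n) (S : {set 'I_n}) (k s : 'I_n).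

(** Once the indices in S are listed first, the matrix is block triangular with an
    identity block at the bottom. *)
Lemma det_rows_outside N S :
  \det (\matrix_(i, j) (if i \in S then N i j else (i == j)%:R)) =
  principal_minor N S.
Proof.
set A := \matrix_(i, j) _.
have e : (#|S| + #|~: S| = n)%N by rewrite cardsC card_ord.
pose h (x : 'I_(#|S| + #|~: S|)) : 'I_n :=
  match fintype.split x with inl a => enum_val a | inr b => enum_val b end.
have hI : injective h.
  move=> x y; rewrite /h -{2}[x]splitK -{2}[y]splitK.
  case: (fintype.split x) => u; case: (fintype.split y) => v E.
  - by rewrite (enum_val_inj E).
  - by have := enum_valP v; rewrite -E inE enum_valP.
  - by have := enum_valP u; rewrite E inE enum_valP.
  - by rewrite (enum_val_inj E).
rewrite -(det_mxsub_inj e A hI) -[mxsub h h A]submxK.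
have -> : dlsubmx (mxsub h h A) = 0.
  apply/matrixP => i j; rewrite !mxE /h.
  case: splitP => a; [by move=> Ea; have := ltn_ord a; rewrite -Ea /= ltnNge leq_addr|].
  move=> /= /addnI/val_inj <-; case: splitP => b /= Eb; last first.
    by have := ltn_ord j; rewrite Eb /= ltnNge leq_addr.
  have := enum_valP i; rewrite inE => /negbTE ->.
  case: eqP => // E; have := enum_valP i; rewrite E inE.
  by rewrite enum_valP.
rewrite det_ublock.
have -> : drsubmx (mxsub h h A) = 1%:M.
  apply/matrixP => i j; rewrite !mxE /h.
  case: splitP => a; [by move=> Ea; have := ltn_ord a; rewrite -Ea /= ltnNge leq_addr|].
  move=> /= /addnI/val_inj <-; case: splitP => b /= Eb.
    by have := ltn_ord b; rewrite -Eb ltnNge leq_addr.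
  move: Eb => /addnI/val_inj <-.
  have := enum_valP i; rewrite inE => /negbTE ->.
  by rewrite (inj_eq enum_val_inj).
rewrite det1 mulr1 /principal_minor; congr (\det _).
apply/matrixP => i j; rewrite !mxE /h.
case: splitP => a /= Ea; last by have := ltn_ord i; rewrite Ea ltnNge leq_addr.
case: splitP => b /= Eb; last by have := ltn_ord j; rewrite Eb ltnNge leq_addr.
by rewrite (val_inj Ea) (val_inj Eb) enum_valP.
Qed.

(** Multilinearity in the rows: S is the set of rows taken from N.  When k is not
    in S, the k-th row is taken from the diagonal part, whose entry at k is 0, and
    the determinant vanishes. *)
Lemma det_diag_add (x : K) N k :
  (\det (\matrix_(i, j) (x *+ ((i == j) && (j != k)) + N i j))) =
  \sum_(S : {set 'I_n} | k \in S) x ^+ (n - #|S|) * principal_minor N S.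
Proof.
pose D (S : {set 'I_n}) := \matrix_(i, j)
  (if i \in S then N i j else x *+ ((i == j) && (j != k))).
transitivity (\sum_(S : {set 'I_n}) \det (D S)).
  rewrite /determinant exchange_big /=; apply: eq_bigr => p _.
  rewrite -big_distrr /=; congr (_ * _).
  under eq_bigr do rewrite mxE addrC.
  rewrite bigA_distr; apply: eq_bigr => S _; apply: eq_bigr => i _.
  by rewrite mxE.
rewrite (bigID (fun S : {set 'I_n} => k \in S)) /= [X in _ + X]big1 ?addr0.
  apply: eq_bigr => S kS.
  have -> : D S = diag_mx (\row_i (if i \in S then 1 else x)) *m
      \matrix_(i, j) (if i \in S then N i j else (i == j)%:R).
    apply/matrixP => i j; rewrite mul_diag_mx !mxE.
    case: ifP => iS; first by rewrite mul1r.
    rewrite mulr_natr; case: (eqVneq i j) => [<-|] //=.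
    by rewrite (_ : i != k)//; apply: contraFneq iS => ->.
  rewrite det_mulmx det_rows_outside det_diag; congr (_ * _).
  rewrite (bigID (mem S)) /= big1 ?mul1r; last by move=> i iS; rewrite mxE iS.
  rewrite (eq_bigr (fun=> x)); last by move=> i /negbTE iS; rewrite mxE iS.
  rewrite prodr_const; congr (_ ^+ _).
  by rewrite -[X in (X - _)%N](card_ord n) -(cardC S) addKn; apply: eq_card.
move=> S kS; rewrite (expand_det_row _ k) big1// => j _.
by rewrite mxE (negbTE kS) eq_sym andbN mulr0n mul0r.
Qed.

End MinorExpansion.

Section CharAdjugate.
Variables (K : comNzRingType) (n : nat) (B : 'M[K]_n).
Implicit Types (k s : 'I_n).

(** The entry (k, s) of the adjugate is the determinant of the characteristic matrix
    with its k-th column replaced by the s-th basis vector; that column carries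
    no X, which is the shape expanded in det_diag_add. *)
Lemma adj_char_coef k s :
  (\adj (char_poly_mx B)) k s =
  \sum_(j < n.+1) (sum_coef B k j s)%:P * 'X^(n - j).
Proof.
(* Off the k-th column the constant part is - B, hence the signs below: a minor on
   S, which contains k, gets #|S| - 1 of them. *)
pose sg (j : 'I_n) : K := if j == k then 1 else -1.
pose N : 'M[{poly K}]_n :=
  \matrix_(i, j) (sg j * subst_col k (delta_mx s 0) B i j)%:P.
pose A : 'M[{poly K}]_n := \matrix_(i, j) ('X *+ ((i == j) && (j != k)) + N i j).
have -> : (\adj (char_poly_mx B)) k s = \det A.
  rewrite (expand_det_col _ k) (bigD1 s)//= big1 ?addr0 => [|i /negbTE nis].
    rewrite !mxE !eqxx andbF mulr0n add0r /sg !eqxx !mul1r.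
    rewrite /cofactor; congr (_ * \det _).
    apply/matrixP => i j; rewrite !mxE /sg; have := neq_lift k j.
    rewrite eq_sym => /negbTE ->.
    by rewrite andbT mulN1r polyCN.
  by rewrite !mxE eqxx andbF mulr0n add0r /sg ?eqxx nis mulr0 mul0r.
rewrite det_diag_add.
have pmN (S : {set 'I_n}) : k \in S -> principal_minor N S =
    ((-1) ^+ #|S|.-1 * principal_minor (subst_col k (delta_mx s 0) B) S)%:P.
  move=> kS; rewrite /principal_minor.
  set P := subst_col _ _ _; set f := fun i : 'I_#|S| => _.
  have -> : mxsub f f N = map_mx polyC (mxsub f f P *m diag_mx (\row_i sg (f i))).
    by apply/matrixP => i j; rewrite mul_mx_diag !mxE mulrC.
  rewrite det_map_mx det_mulmx det_diag mulrC; congr (_ * _)%:P.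
  under eq_bigr do rewrite mxE.
  rewrite -(big_enum_val sg) (bigD1 k)//= {1}/sg eqxx mul1r.
  rewrite (eq_bigr (fun=> -1)); last by move=> i /andP[_ /negbTE ik]; rewrite /sg ik.
  rewrite prodr_const; congr (_ ^+ _).
  rewrite (cardsD1 k S) kS add1n /=; apply: eq_card => i.
  by rewrite !inE andbC.
rewrite (partition_big (fun S : {set 'I_n} => inord #|S| : 'I_n.+1) xpredT)//=.
apply: eq_bigr => j _; rewrite /sum_coef /delta mulr_sumr rmorph_sum mulr_suml /=.
apply: eq_big => [S|S /andP[kS /eqP Sj]].
  rewrite andbC; congr (_ && _); rewrite -(inj_eq val_inj) /= inordK//.
  by rewrite ltnS -[X in (_ <= X)%N](card_ord n) max_card.
have cS : #|S| = j.
  by rewrite -Sj inordK// ltnS -[X in (_ <= X)%N](card_ord n) max_card.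
by rewrite pmN// cS mulrC.
Qed.

Lemma adj_char_eq0 k s : (\adj (char_poly_mx B)) k s = 0 <->
  (forall j : nat, (1 <= j <= n)%N -> sum_coef B k j s = 0).
Proof.
rewrite adj_char_coef; split=> [E j /andP[_ jn]|H].
  have jn' : (j < n.+1)%N by [].
  have /(congr1 (fun p : {poly K} => p`_(n - j))) := E.
  rewrite coef_sum (bigD1 (Ordinal jn')) //= big1 => [|i ij].
    by rewrite addr0 coefCM coefXn eqxx mulr1 coef0.
  rewrite coefCM coefXn (_ : _ == _ = false) ?mulr0//.
  apply: contra_neqF ij => /eqP nji; apply/val_inj => /=.
  by have := ltn_ord i; rewrite ltnS => ilen; rewrite -(subKn jn) nji subKn.
apply: big1 => -[[|j] jn] _ /=; last by rewrite H//= mul0r.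
rewrite /sum_coef /delta big_pred0 ?mulr0 ?mul0r// => S.
by apply/negP => /andP[/eqP/cards0_eq-> ]; rewrite inE.
Qed.

End CharAdjugate.

(** * Algebraic dependence over a subfield *)
Section AlgebraicClosure.
Variable K : fieldType.
Implicit Types (F G : K -> Prop) (u v x y : K) (p q : {poly K}).

Record subfield F : Prop := Subfield {
  subfield1 : F 1;
  subfieldB : forall x y, F x -> F y -> F (x - y);
  subfield_div : forall x y, F x -> F y -> F (x / y) }.

Definition poly_over F p := forall i, F p`_i.

Definition algebraic F u := exists p, [/\ p != 0, poly_over F p & root p u].

Section SubfieldOperations.
Variables (F : K -> Prop) (sF : subfield F).

Lemma subfield0 : F 0.
Proof. by rewrite -(subrr 1); apply: subfieldB => //; exact: subfield1. Qed.

Lemma subfieldN x : F x -> F (- x).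
Proof. by move=> Fx; rewrite -sub0r; apply: subfieldB => //; exact: subfield0. Qed.

Lemma subfieldD x y : F x -> F y -> F (x + y).
Proof. by move=> Fx Fy; rewrite -[y]opprK; apply: subfieldB => //; exact: subfieldN. Qed.

Lemma subfieldV x : F x -> F x^-1.
Proof. by move=> Fx; rewrite -[_^-1]mul1r; apply: subfield_div => //; exact: subfield1. Qed.

Lemma subfieldM x y : F x -> F y -> F (x * y).
Proof. by move=> Fx Fy; rewrite -[y]invrK; apply: subfield_div => //; exact: subfieldV. Qed.

Lemma subfieldX x n : F x -> F (x ^+ n).
Proof.
move=> Fx; elim: n => [|n IH]; first exact: subfield1.
by rewrite exprS; exact: subfieldM.
Qed.

Lemma subfield_sum (I : Type) (r : seq I) (P : pred I) (f : I -> K) :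
  (forall i, P i -> F (f i)) -> F (\sum_(i <- r | P i) f i).
Proof. by move=> H; apply: big_ind => //; [exact: subfield0|exact: subfieldD]. Qed.

Lemma subfield_horner p x : poly_over F p -> F x -> F p.[x].
Proof.
move=> Fp Fx; rewrite horner_coef; apply: subfield_sum => i _.
by apply: subfieldM; [exact: Fp|exact: subfieldX].
Qed.

Definition subfield_pred (s : subfield F) : {pred K} := fun x => `[< F x >].

Fact subfield_pred_divring : divring_closed (subfield_pred sF).
Proof.
split; first by apply/asboolP; exact: subfield1.
- by move=> x y /asboolP Fx /asboolP Fy; apply/asboolP; exact: subfieldB.
- by move=> x y /asboolP Fx /asboolP Fy; apply/asboolP; exact: subfield_div.
Qed.

HB.instance Definition _ :=
  GRing.isDivringClosed.Build K (subfield_pred sF) subfield_pred_divring.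

(** F as a field of its own, over which the theory of integral elements applies. *)
Record subfield_type := SubfieldType {
  sval_sf : K;
  sval_sfP : sval_sf \in subfield_pred sF }.

HB.instance Definition _ := [isSub for sval_sf].
HB.instance Definition _ := [Choice of subfield_type by <:].
HB.instance Definition _ := [SubChoice_isSubIntegralDomain of subfield_type by <:].
HB.instance Definition _ := [SubIntegralDomain_isSubField of subfield_type by <:].

Lemma algebraic_overP u :
  algebraic F u <-> algebraicOver (val : subfield_type -> K) u.
Proof.
split=> [[p [p0 Fp pu]]|[p p0 pu]].
  pose lift x : subfield_type := insubd 0 x.
  have liftE x : F x -> val (lift x) = x.
    by move=> Fx; rewrite /lift insubdK//; apply/asboolP.
  have v0 : val (0 : subfield_type) = 0 by rewrite rmorph0.
  have pE : map_poly val (\poly_(i < size p) lift p`_i) = p.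
    apply/polyP => i; rewrite coef_map coef_poly /=.
    case: ifP => ip; first by rewrite liftE.
    transitivity (0 : K); first exact: v0.
    by apply/esym/nth_default; rewrite leqNgt ip.
  exists (\poly_(i < size p) lift p`_i); last by rewrite pE.
  by apply: contra_neq p0 => p0; rewrite -pE p0 rmorph0.
exists (map_poly val p); split=> //; first by rewrite map_poly_eq0.
by move=> i; rewrite coef_map /=; have /asboolP := sval_sfP p`_i.
Qed.

Lemma algebraic_id u : F u -> algebraic F u.
Proof.
move=> Fu; exists ('X - u%:P); split; first by rewrite polyXsubC_eq0.
  move=> i; rewrite coefB coefX coefC; apply: subfieldB => //.
    by case: eqP => _; [exact: subfield1|exact: subfield0].
  by case: eqP => _ //; exact: subfield0.
by rewrite root_XsubC.
Qed.

Lemma subfield_algebraic : subfield (algebraic F).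
Proof.
split; first by apply: algebraic_id; exact: subfield1.
- move=> x y /algebraic_overP ax /algebraic_overP ay; apply/algebraic_overP.
  exact: algebraic_sub.
- move=> x y /algebraic_overP ax /algebraic_overP ay; apply/algebraic_overP.
  exact: algebraic_div.
Qed.

Lemma algebraic_trans u : algebraic (algebraic F) u -> algebraic F u.
Proof.
move=> [p [p0 Fp pu]]; apply/algebraic_overP/integral_algebraic.
apply: integral_root p0 pu _ => _ /(nthP 0)[i _ <-].
by apply/integral_algebraic/algebraic_overP; exact: Fp.
Qed.

End SubfieldOperations.

Lemma algebraic_mono F G u : (forall x, F x -> G x) -> algebraic F u -> algebraic G u.
Proof. by move=> FG [p [p0 Fp pu]]; exists p; split=> // i; exact/FG/Fp. Qed.

(** The field F(x), as fractions in x over F. *)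
Definition adjoin F x : K -> Prop := fun u => exists p q,
  [/\ poly_over F p, poly_over F q, q.[x] != 0 & u = p.[x] / q.[x]].

Section Adjoin.
Variables (F : K -> Prop) (sF : subfield F).

Lemma poly_over0 : poly_over F 0.
Proof. by move=> i; rewrite coef0; exact: subfield0. Qed.

Lemma poly_overC c : F c -> poly_over F c%:P.
Proof. by move=> Fc i; rewrite coefC; case: eqP => // _; exact: subfield0. Qed.

Lemma poly_overX : poly_over F 'X.
Proof.
by move=> i; rewrite coefX; case: eqP => _; [exact: subfield1|exact: subfield0].
Qed.

Lemma poly_overB p q : poly_over F p -> poly_over F q -> poly_over F (p - q).
Proof. by move=> Fp Fq i; rewrite coefB; exact: subfieldB. Qed.

Lemma poly_overM p q : poly_over F p -> poly_over F q -> poly_over F (p * q).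
Proof.
by move=> Fp Fq i; rewrite coefM; apply: subfield_sum => // j _; exact: subfieldM.
Qed.

Lemma adjoin_sub x u : F u -> adjoin F x u.
Proof.
move=> Fu; exists u%:P, 1%:P; split; rewrite ?hornerC ?oner_eq0 ?divr1//.
  exact: poly_overC.
by apply: poly_overC; exact: subfield1.
Qed.

Lemma adjoin_gen x : adjoin F x x.
Proof.
exists 'X, 1%:P; split; rewrite ?hornerX ?hornerC ?oner_eq0 ?divr1//.
  exact: poly_overX.
by apply: poly_overC; exact: subfield1.
Qed.

Lemma subfield_adjoin x : subfield (adjoin F x).
Proof.
split; first by apply: adjoin_sub; exact: subfield1.
- move=> _ _ [p [q [Fp Fq q0 ->]]] [p' [q' [Fp' Fq' q'0 ->]]].
  exists (p * q' - p' * q), (q * q'); split.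
  + by apply: poly_overB; exact: poly_overM.
  + exact: poly_overM.
  + by rewrite hornerM mulf_neq0.
  + by rewrite hornerD hornerN !hornerM; field; rewrite q0 q'0.
- move=> _ _ [p [q [Fp Fq q0 ->]]] [p' [q' [Fp' Fq' q'0 ->]]].
  have [p'0|p'0] := eqVneq p'.[x] 0.
    rewrite p'0 mul0r invr0 mulr0; apply: adjoin_sub; exact: subfield0.
  exists (p * q'), (q * p'); split; try exact: poly_overM.
    by rewrite hornerM mulf_neq0.
  by rewrite !hornerM; field; rewrite q0 q'0 p'0.
Qed.

Lemma adjoin_least G x u : subfield G -> (forall v, F v -> G v) -> G x ->
  adjoin F x u -> G u.
Proof.
move=> sG FG Gx [p [q [Fp Fq q0 ->]]].
by apply: subfield_div => //; apply: subfield_horner => // i; exact/FG.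
Qed.

End Adjoin.

Lemma common_denominator (S : K -> Prop) (p : {poly K}) :
  S 0 -> S 1 -> (forall x y, S x -> S y -> S (x * y)) ->
  (forall i, exists a b, [/\ S a, S b, b != 0 & p`_i = a / b]) ->
  exists b, [/\ S b, b != 0 & forall i, S (b * p`_i)].
Proof.
move=> S0 S1 SM; elim/poly_ind: p => [_|p c IH H].
  by exists 1; split; rewrite ?oner_eq0// => i; rewrite coef0 mulr0.
have [|b [Sb b0 Hb]] := IH.
  by move=> i; have := H i.+1; rewrite coefD coefMX coefC addr0.
have := H 0%N; rewrite coefD coefMX coefC /= add0r => -[a [d [Sa Sd d0 ->]]].
exists (b * d); split; [exact: SM|by rewrite mulf_neq0|].
move=> [|i]; rewrite coefD coefMX coefC /= ?add0r ?addr0.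
  by rewrite (_ : b * d * (a / d) = b * a); [exact: SM|field].
by rewrite mulrAC; exact: SM.
Qed.

(** Clearing denominators gives a relation P(x, y) = 0 with coefficients in F,
    nontrivial as a polynomial in y.  Read as a polynomial in x, it has
    coefficients c_i(y) with some c_i nonzero, and c_i(y) is nonzero because y is
    transcendental over F. *)
Lemma exchange F x y : subfield F -> algebraic (adjoin F x) y -> ~ algebraic F y ->
  algebraic (adjoin F y) x.
Proof.
move=> sF [p [p0 Fp py]] nFy.
pose S u := exists f, poly_over F f /\ u = f.[x].
have [||||b [_ b0 Hb]] := @common_denominator S p.
- by exists 0; split; [exact: poly_over0|rewrite horner0].
- exists 1; split; last by rewrite hornerC.
  by apply: poly_overC => //; exact: subfield1.
- move=> _ _ [f [Ff ->]] [g [Fg ->]]; exists (f * g).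
  by split; [exact: poly_overM|rewrite hornerM].
- move=> i; have [f [g [Ff Fg g0 ->]]] := Fp i.
  by exists f.[x], g.[x]; split=> //; [exists f|exists g].
have [f Hf] := choice Hb.
pose P := \poly_(i < size p) f i.
have PE : map_poly (horner_eval x) P = b *: p.
  apply/polyP => i; rewrite coef_map coef_poly coefZ /=.
  case: ifP => [_|/negbT ip]; first by have [_ ->] := Hf i.
  by rewrite /horner_eval horner0 nth_default ?mulr0// leqNgt.
have FP i j : F (P`_i)`_j.
  rewrite coef_poly; case: ifP => _; first by have [+ _] := Hf i; apply.
  by rewrite coef0; exact: subfield0.
have P0 : P != 0.
  apply: contra_neq p0 => P0; move: PE; rewrite P0 map_poly0 => /esym/eqP.
  by rewrite scaler_eq0 (negbTE b0) => /eqP.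
pose Q := map_poly (horner_eval y) (swapXY P).
have Qi i : Q`_i = ((swapXY P)`_i).[y] by rewrite coef_map.
have FsP i : poly_over F (swapXY P)`_i by move=> j; rewrite coef_swapXY.
exists Q; split.
- have /eqP : swapXY P != 0 by rewrite swapXY_eq0.
  apply: contra_not_neq => Q0; apply/polyP => i; rewrite coef0; apply/eqP.
  apply: contra_notT nFy => sPi.
  exists (swapXY P)`_i; split=> //.
  by rewrite rootE -Qi Q0 coef0.
- by move=> i; rewrite Qi; apply: subfield_horner;
    [exact: subfield_adjoin|move=> j; apply: adjoin_sub => //; exact: FsP|exact: adjoin_gen].
rewrite rootE -[Q](horner_swapXY (swapXY P)) swapXYK.
rewrite -[_.[x]]/(P.[y, x]) -horner2_swapXY.
by rewrite /= horner_swapXY PE hornerZ (rootP py) mulr0.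
Qed.

Definition generated F (ts : seq K) : K -> Prop := foldl adjoin F ts.

Lemma subfield_generated F ts : subfield F -> subfield (generated F ts).
Proof. by elim: ts F => //= t ts IH F sF; apply: IH; exact: subfield_adjoin. Qed.

Lemma generated_sub F ts u : subfield F -> F u -> generated F ts u.
Proof.
elim: ts F => //= t ts IH F sF Fu.
by apply: IH; [exact: subfield_adjoin|exact: adjoin_sub].
Qed.

Lemma generated_mem F ts u : subfield F -> u \in ts -> generated F ts u.
Proof.
elim: ts F => //= t ts IH F sF; rewrite inE => /orP[/eqP->|uts].
  by apply: generated_sub; [exact: subfield_adjoin|exact: adjoin_gen].
by apply: IH => //; exact: subfield_adjoin.
Qed.

Lemma generated_least F G ts u : subfield G -> (forall v, F v -> G v) ->
  (forall t, t \in ts -> G t) -> generated F ts u -> G u.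
Proof.
move=> sG; elim: ts F => [|t ts IH] F /= FG Gts; first exact: FG.
apply: IH => [v|s sts]; last by apply: Gts; rewrite inE sts orbT.
by apply: adjoin_least => //; apply: Gts; exact: mem_head.
Qed.

Fixpoint dependent F (ys : seq K) : Prop :=
  if ys is y :: ys' then algebraic F y \/ dependent (adjoin F y) ys' else False.

(** If t is the first generator for which y becomes algebraic, then y can take the
    place of t by exchange. *)
Lemma replace_generator F ts y : subfield F ->
  algebraic (generated F ts) y -> ~ algebraic F y ->
  exists ts', (size ts').+1 = size ts /\
    forall u, algebraic (generated F ts) u -> algebraic (generated (adjoin F y) ts') u.
Proof.
elim: ts F => [//|t ts IH] F sF /= ay nay.
have [aty|naty] := pselect (algebraic (adjoin F t) y).
  exists ts; split=> // u au.
  have sG := subfield_generated ts (subfield_adjoin sF y).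
  apply: (algebraic_trans sG); apply: algebraic_mono au => v.
  apply: generated_least; first exact: subfield_algebraic.
    move=> w; apply: adjoin_least; first exact: subfield_algebraic.
      move=> s Fs; apply: algebraic_id => //; apply: generated_sub.
        exact: subfield_adjoin.
      exact: adjoin_sub.
    apply: algebraic_mono (exchange sF aty nay) => s.
    by apply: generated_sub; exact: subfield_adjoin.
  move=> s sts; apply: algebraic_id => //; apply: generated_mem => //.
  exact: subfield_adjoin.
have [ts' [sz H]] := IH _ (subfield_adjoin sF t) ay naty.
exists (t :: ts'); split=> [|u /H]; first by rewrite /= sz.
apply: algebraic_mono => v.
have sy := subfield_adjoin sF y; have syt := subfield_adjoin sy t.
apply: generated_least; first exact: subfield_generated.
  move=> w aw; apply: (@generated_sub (adjoin (adjoin F y) t) ts') => //; move: aw.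
  apply: (adjoin_least syt).
    move=> s; apply: (adjoin_least syt) => [r Fr|].
      by apply: (adjoin_sub sy); exact: (adjoin_sub sF).
    exact: (adjoin_gen sy).
  by apply: adjoin_sub => //; exact: adjoin_gen.
by move=> s; exact: (@generated_mem (adjoin (adjoin F y) t) ts').
Qed.

(** The elements of ys replace generators one at a time; there are more of them
    than generators, so one of them must be dependent on its predecessors. *)
Lemma steinitz F ts ys : subfield F -> (size ts < size ys)%N ->
  (forall y, y \in ys -> algebraic (generated F ts) y) -> dependent F ys.
Proof.
elim: ys F ts => // y ys IH F ts sF; rewrite ltnS => sz H /=.
have [ay|nay] := pselect (algebraic F y); [by left|right].
have [ts' [sz' Hts']] := replace_generator sF (H y (mem_head _ _)) nay.
apply: (IH _ ts'); first exact: subfield_adjoin.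
  by rewrite sz'.
by move=> z zys; apply/Hts'/H; rewrite inE zys orbT.
Qed.

Lemma dependentP F ys : dependent F ys ->
  exists i, (i < size ys)%N /\ algebraic (generated F (take i ys)) ys`_i.
Proof.
elim: ys F => //= y ys IH F [ay|/IH [i [isz ai]]]; first by exists 0%N.
by exists i.+1.
Qed.

End AlgebraicClosure.

(** * Differentially algebraic elements of a differential field *)
Section DifferentialField.
Variables (C0 K : fieldType) (iota : {rmorphism C0 -> K}) (d : K -> K).
Hypothesis derD : {morph d : x y / x + y}.
Hypothesis derM : forall x y, d (x * y) = d x * y + x * d y.
Hypothesis der_iota : forall c, d (iota c) = 0.
Hypothesis char0 : forall n, n.+1%:R != 0 :> K.
Implicit Types (F : K -> Prop) (u v x y : K) (p q : {poly C0}).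

Lemma der0 : d 0 = 0.
Proof. by rewrite -[in LHS](rmorph0 iota) der_iota. Qed.

Lemma derN x : d (- x) = - d x.
Proof. by apply/eqP; rewrite -addr_eq0 -derD addNr der0. Qed.

Lemma derB x y : d (x - y) = d x - d y.
Proof. by rewrite derD derN. Qed.

Lemma der_sum (I : Type) (r : seq I) (P : pred I) (f : I -> K) :
  d (\sum_(i <- r | P i) f i) = \sum_(i <- r | P i) d (f i).
Proof. exact: (big_morph d derD der0). Qed.

Lemma derV x : d x^-1 = - d x / x ^+ 2.
Proof.
have [->|x0] := eqVneq x 0; first by rewrite invr0 der0 oppr0 mul0r.
have : d (x * x^-1) = 0 by rewrite divff// -(rmorph1 iota) der_iota.
rewrite derM => /eqP; rewrite addrC addr_eq0 => /eqP E.
by apply: (mulfI x0); rewrite E; field.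
Qed.

Lemma derX x n : d (x ^+ n) = n%:R * x ^+ n.-1 * d x.
Proof.
elim: n => [|n IH]; first by rewrite expr0 -(rmorph1 iota) der_iota !mul0r.
rewrite exprS derM IH /=; case: n {IH} => [|n]; first by rewrite /= !expr0; ring.
by rewrite /= exprS -[n.+2]addn1 natrD; ring.
Qed.

Lemma der_horner (p : {poly K}) u :
  d p.[u] = (map_poly d p).[u] + p^`().[u] * d u.
Proof.
rewrite horner_coef der_sum.
rewrite (@horner_coef_wide _ (size p)) ?size_poly//.
rewrite (@horner_coef_wide _ (size p) p^`()); last first.
  by rewrite (leq_trans (size_poly _ _))// leq_pred.
rewrite mulr_suml -[X in _ + X](_ :
    \sum_(i < size p) p`_i * (i%:R * u ^+ i.-1) * d u = _).
  rewrite -big_split; apply: eq_bigr => i _ /=.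
  by rewrite derM coef_map_id0 ?der0// derX; ring.
case E: (size p) => [|n]; first by rewrite !big_ord0.
have sp : (size p <= n.+1)%N by rewrite E.
rewrite big_ord_recl [in RHS]big_ord_recr /= mul0r mulr0 mul0r add0r.
rewrite coef_deriv (nth_default _ sp) mul0rn !mul0r addr0.
by apply: eq_bigr => i _; rewrite coef_deriv /bump !add1n add0n -[in RHS]mulr_natr !mulrA.
Qed.

(** Differentiating p(u) = 0, with p of minimal degree over F, gives
    p^d(u) + p'(u) d u = 0, where d acts on the coefficients in p^d.  In
    characteristic 0, p' is nonzero and of smaller degree, so p'(u) is nonzero and
    d u can be solved for. *)
Lemma algebraic_derivation F u : subfield F ->
  (forall x, F x -> algebraic F (d x)) -> algebraic F u -> algebraic F (d u).
Proof.
move=> sF Fd [p0 [p0n0 Fp0 p0u]].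
pose good n := `[< exists p : {poly K}, [/\ size p = n, p != 0, poly_over F p & root p u] >].
have exg : exists n, good n by exists (size p0); apply/asboolP; exists p0.
case: (ex_minnP exg) => n /asboolP [p [sp pn0 Fp pu]] nmin.
have sA := subfield_algebraic sF.
have Au : algebraic F u by exists p0.
have dp0 : p^`() != 0.
  apply/eqP => dp0; have sp1 : (size p <= 1)%N.
    apply/leq_sizeP => -[//|j] _; have := congr1 (fun q : {poly K} => q`_j) dp0.
    rewrite coef_deriv coef0 -mulr_natr => /eqP; rewrite mulf_eq0 (negbTE (char0 _)).
    by rewrite orbF => /eqP.
  move: pu pn0; rewrite (size1_polyC sp1) rootC => /eqP ->.
  by rewrite eqxx.
have Fdp : poly_over F p^`().
  move=> i; rewrite coef_deriv -mulr_natr; apply: subfieldM => //.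
  elim: i.+1 => [|m IH]; first exact: subfield0.
  by rewrite mulrSr; apply: subfieldD => //; exact: subfield1.
have dpu : p^`().[u] != 0.
  apply/negP => dpu.
  have : (n <= size p^`())%N by apply: nmin; apply/asboolP; exists p^`(); split.
  rewrite -sp; apply/negP; rewrite -ltnNge; exact: lt_size_deriv.
have := der_horner p u; rewrite (rootP pu) der0 => /esym/eqP.
rewrite addrC addr_eq0 => /eqP E.
have -> : d u = - (map_poly d p).[u] / p^`().[u] by rewrite -E mulrAC mulfV ?mul1r.
apply: (subfield_div sA).
  apply: (subfieldN sA); apply: (subfield_horner sA) => // i.
  by rewrite coef_map_id0 ?der0//; exact/Fd/Fp.
by apply: (subfield_horner sA) => // i; apply: algebraic_id => //; exact: Fdp.
Qed.

Definition constants : K -> Prop := fun x => exists c, x = iota c.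

Lemma subfield_constants : subfield constants.
Proof.
split; first by exists 1; rewrite rmorph1.
- by move=> _ _ [a ->] [b ->]; exists (a - b); rewrite rmorphB.
- by move=> _ _ [a ->] [b ->]; exists (a / b); rewrite fmorph_div.
Qed.

Definition jet y n := mkseq (fun j => iter j d y) n.

(** The same as a polynomial relation between derivatives of y, by
    mpoly_relation_algebraic and algebraic_mpoly_relation below. *)
Definition diffalg y := exists i, algebraic (generated constants (jet y i)) (iter i d y).

(** The derivatives of the generators of F are algebraic over F, so the algebraic
    closure of F in K is stable under d; it contains y. *)
Lemma algebraic_jet y i : algebraic (generated constants (jet y i)) (iter i d y) ->
  forall j, algebraic (generated constants (jet y i)) (iter j d y).
Proof.
move=> ai; have a0 : algebraic (generated constants (jet y i)) y.
  case: i ai => [//|i] _; have sC := subfield_constants.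
  apply: algebraic_id; first exact: subfield_generated.
  by apply: generated_mem => //; apply/mapP; exists 0%N => //; rewrite mem_iota.
set F := generated _ _ in ai a0 *.
have sF : subfield F by apply: subfield_generated; exact: subfield_constants.
have sA := subfield_algebraic sF.
have Fd x : F x -> algebraic F (d x).
  move=> Fx; suff [] : algebraic F x /\ algebraic F (d x) by [].
  move: Fx; apply: (@generated_least _ constants
    (fun x => algebraic F x /\ algebraic F (d x))).
  - split.
    + split; first exact: (subfield1 sA).
      by rewrite -(rmorph1 iota) der_iota; exact: (subfield0 sA).
    + move=> v w [v1 v2] [w1 w2]; split; first exact: (subfieldB sA).
      by rewrite derB; exact: (subfieldB sA).
    + move=> v w [v1 v2] [w1 w2]; split; first exact: (subfield_div sA).
      have w3 := subfieldV sA w1.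
      rewrite derM derV; apply: (subfieldD sA); first exact: (subfieldM sA).
      apply: (subfieldM sA) => //; apply: (subfield_div sA); first exact: (subfieldN sA).
      exact: (subfieldX sA).
  - move=> _ [c ->]; split; last by rewrite der_iota; exact: (subfield0 sA).
    apply: algebraic_id => //; apply: generated_sub; first exact: subfield_constants.
    by exists c.
  - move=> t /mapP [j]; rewrite mem_iota /= add0n => ji ->; split.
      apply: algebraic_id => //; apply: generated_mem; first exact: subfield_constants.
      by apply/mapP; exists j => //; rewrite mem_iota.
    rewrite -iterS; have [ji'|] := ltnP j.+1 i.
      apply: algebraic_id => //; apply: generated_mem; first exact: subfield_constants.
      by apply/mapP; exists j.+1 => //; rewrite mem_iota.
    by move=> ij; rewrite (_ : j.+1 = i)//; apply/eqP; rewrite eqn_leq ij ji.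
elim=> [|j IH]; last by rewrite iterS; exact: algebraic_derivation.
exact: a0.
Qed.

(** The differential operator p(d) applied to u. *)
Definition act p u : K := \sum_(i < size p) iota p`_i * iter i d u.

Lemma act_wide p u n : (size p <= n)%N -> act p u = \sum_(i < n) iota p`_i * iter i d u.
Proof.
move=> pn; rewrite /act (big_ord_widen n (fun i => iota p`_i * iter i d u) pn).
rewrite big_mkcond; apply: eq_bigr => i _; case: ltnP => // ip.
by rewrite nth_default// rmorph0 mul0r.
Qed.

Lemma act0 u : act 0 u = 0.
Proof. by rewrite /act size_poly0 big_ord0. Qed.

Lemma actD p q u : act (p + q) u = act p u + act q u.
Proof.
rewrite (act_wide _ (size_polyD p q)) (act_wide u (leq_maxl (size p) (size q))).
rewrite (act_wide u (leq_maxr (size p) (size q))) -big_split /=.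
by apply: eq_bigr => i _; rewrite coefD rmorphD mulrDl.
Qed.

Lemma actC c u : act c%:P u = iota c * u.
Proof.
by rewrite (@act_wide _ _ 1) ?size_polyC_leq1// big_ord1 coefC.
Qed.

Lemma act_sum (I : Type) (r : seq I) (P : pred I) (f : I -> {poly C0}) u :
  act (\sum_(i <- r | P i) f i) u = \sum_(i <- r | P i) act (f i) u.
Proof. by apply: (big_morph (act^~ u)) => [p q|]; [exact: actD|exact: act0]. Qed.

Lemma iter_derD n u v : iter n d (u + v) = iter n d u + iter n d v.
Proof. by elim: n => //= n ->; rewrite derD. Qed.

Lemma actDr p u v : act p (u + v) = act p u + act p v.
Proof.
by rewrite /act -big_split; apply: eq_bigr => i _; rewrite iter_derD mulrDr.
Qed.

Lemma iter_der0 n : iter n d 0 = 0.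
Proof. by elim: n => //= n ->; rewrite der0. Qed.

Lemma act_sumr (I : Type) (r : seq I) (P : pred I) p (f : I -> K) :
  act p (\sum_(i <- r | P i) f i) = \sum_(i <- r | P i) act p (f i).
Proof.
apply: (big_morph (act p)) => [u v|]; first exact: actDr.
by apply: big1 => i _; rewrite iter_der0 mulr0.
Qed.

Lemma actMX p u : act (p * 'X) u = act p (d u).
Proof.
rewrite (@act_wide _ _ (size p).+1); last first.
  by rewrite (leq_trans (size_polyMleq _ _))// size_polyX addn2.
rewrite big_ord_recl coefMX /= rmorph0 mul0r add0r.
by apply: eq_bigr => i _; rewrite coefMX /= -iterSr.
Qed.

Lemma der_act p u : d (act p u) = act p (d u).
Proof.
rewrite /act der_sum; apply: eq_bigr => i _.
by rewrite derM der_iota mul0r add0r -iterS iterSr.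
Qed.

Lemma actM p q u : act (p * q) u = act p (act q u).
Proof.
elim/poly_ind: p u q => [|p c IH] u q; first by rewrite mul0r !act0.
rewrite mulrDl !actD -mulrA IH (mulrC 'X) actMX actMX der_act; congr (_ + _).
rewrite actC mul_polyC (@act_wide _ _ (size q)) ?size_scale_leq//.
by rewrite /act mulr_sumr; apply: eq_bigr => i _; rewrite coefZ rmorphM mulrA.
Qed.

Lemma iter_der_act n p u : iter n d (act p u) = act p (iter n d u).
Proof. by elim: n => //= n ->; rewrite der_act. Qed.

Lemma subfield_act F p u : subfield F -> (forall c, constants c -> F c) ->
  (forall i, (i < size p)%N -> F (iter i d u)) -> F (act p u).
Proof.
move=> sF FC Fu; apply: subfield_sum => // i _; apply: subfieldM => //; last exact: Fu.
by apply: FC; eexists.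
Qed.

(** Let F be generated by the jets of the ys s, each up to the order from which on
    its derivatives are algebraic, and by the derivatives of y of order less than
    the degree of L.  The equation and its derivatives express the higher
    derivatives of y, so they are all algebraic over F; by steinitz, more of them
    than F has generators must be dependent. *)
Lemma diffalg_linear (I : finType) (P : pred I) (L : {poly C0}) (Ls : I -> {poly C0})
    y (ys : I -> K) : L != 0 -> act L y = \sum_(s | P s) act (Ls s) (ys s) ->
  (forall s, P s -> diffalg (ys s)) -> diffalg y.
Proof.
move=> L0 E DA.
have [ord Hord] : {ord : I -> nat & forall s, P s ->
    algebraic (generated constants (jet (ys s) (ord s))) (iter (ord s) d (ys s))}.
  apply: (@choice _ _ (fun s n => P s ->
    algebraic (generated constants (jet (ys s) n)) (iter n d (ys s)))) => s.
  by have [/DA[n Hn]|nP] := boolP (P s); [exists n|exists 0%N].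
pose l := (size L).-1.
have sL : size L = l.+1 by rewrite prednK// size_poly_gt0.
pose ts := jet y l ++ flatten [seq jet (ys s) (ord s) | s <- enum P].
pose F := generated constants ts.
have sC := subfield_constants.
have sF : subfield F by exact: subfield_generated.
have sA := subfield_algebraic sF.
have AC c : constants c -> algebraic F c.
  by move=> ?; apply: algebraic_id => //; exact: generated_sub.
have As s j : P s -> algebraic F (iter j d (ys s)).
  move=> Ps; have := algebraic_jet (Hord s Ps) j; apply: algebraic_mono => u.
  apply: generated_least => // [c|t tj]; first exact: generated_sub.
  apply: generated_mem => //; rewrite mem_cat; apply/orP; right.
  by apply/flatten_mapP; exists s => //; rewrite mem_enum.
have Ay j : algebraic F (iter j d y).
  elim/ltn_ind: j => j IH; have [jl|lj] := ltnP j l.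
    apply: algebraic_id => //; apply: generated_mem => //; rewrite mem_cat.
    by apply/orP; left; apply/mapP; exists j => //; rewrite mem_iota.
  have := congr1 (iter (j - l) d) E; rewrite iter_der_act {1}/act sL big_ord_recr /=.
  rewrite -iterD subnKC//; set S := (X in X + _) => E'.
  have lc : iota L`_l != 0 by rewrite fmorph_eq0 -lead_coefE lead_coef_eq0.
  have -> : iter j d y = iota L`_l * iter j d y / iota L`_l by rewrite mulrC mulKf.
  apply: (subfield_div sA); last by apply: AC; eexists.
  have -> : iota L`_l * iter j d y = iter (j - l) d (\sum_(s | P s) act (Ls s) (ys s)) - S.
    by apply/eqP; rewrite eq_sym subr_eq addrC E'.
  apply: (subfieldB sA); last first.
    apply: (subfield_sum sA) => i _; apply: (subfieldM sA); first by apply: AC; eexists.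
    by rewrite -iterD; apply: IH; rewrite -[ltnRHS](subnKC lj) ltn_add2r.
  rewrite (_ : iter (j - l) d _ = \sum_(s | P s) act (Ls s) (iter (j - l) d (ys s))).
    apply: (subfield_sum sA) => s Ps; apply: subfield_act => // i _.
    by rewrite -iterD; exact: As.
  elim: (j - l)%N => //= n ->; rewrite der_sum; apply: eq_bigr => s _.
  by rewrite der_act.
have dep : dependent constants (jet y (size ts).+1).
  apply: (@steinitz _ _ ts) => //; first by rewrite size_mkseq.
  by move=> z /mapP [j _ ->].
have [i [isz ai]] := dependentP dep; exists i.
move: isz ai; rewrite size_mkseq => isz; rewrite nth_mkseq//.
by rewrite /jet /mkseq -map_take take_iota (minn_idPl (ltnW isz)).
Qed.

(** The system reads M(d) x = phi with M the characteristic matrix; multiply by its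
    adjugate. *)
Lemma system_elimination n (B : 'M[C0]_n) (phi x : 'I_n -> K) :
  (forall i, d (x i) = \sum_(l < n) iota (B i l) * x l + phi i) ->
  forall k, act (char_poly B) (x k) = \sum_s act ((\adj (char_poly_mx B)) k s) (phi s).
Proof.
move=> sol k; set M := char_poly_mx B.
have rowE s : \sum_l act (M s l) (x l) = phi s.
  rewrite (eq_bigr (fun l => d (x l) *+ (s == l) - iota (B s l) * x l)); last first.
    move=> l _; rewrite !mxE -polyCN actD actC rmorphN mulNr; congr (_ - _).
    case: (s == l); last by rewrite mulr0n act0.
    rewrite mulr1n -['X]mul1r actMX.
    by rewrite (_ : 1 = 1%:P)// actC rmorph1 mul1r.
  rewrite big_split /= sumrN (bigD1 s)//= eqxx big1 ?addr0 => [|l /negbTE ls].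
    by rewrite sol addrC addKr.
  by rewrite eq_sym ls.
have pE l : (\adj M *m M) k l = char_poly B *+ (k == l) by rewrite mul_adj_mx mxE.
transitivity (\sum_l act ((\adj M *m M) k l) (x l)).
  rewrite (bigD1 k)//= pE eqxx big1 ?addr0 // => l /negbTE lk.
  by rewrite pE eq_sym lk act0.
under eq_bigr => l _ do rewrite mxE act_sum.
rewrite exchange_big; apply: eq_bigr => s _ /=.
rewrite -rowE act_sumr; apply: eq_bigr => l _; exact: actM.
Qed.

End DifferentialField.

(** * Polynomial relations and algebraic dependence *)
Section MpolyDependence.
Variables (C0 K : fieldType) (iota : {rmorphism C0 -> K}).

Lemma mpoly_morph_ext n (S : comNzRingType) (f g : {rmorphism mpoly n C0 -> S}) :
  (forall c, f (mpolyC n c) = g (mpolyC n c)) ->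
  (forall i, f (mpolyX C0 (mnm1 i)) = g (mpolyX C0 (mnm1 i))) -> f =1 g.
Proof.
move=> fgC fgX; elim/mpolyind => [|c m p _ _ IH]; first by rewrite !rmorph0.
rewrite !rmorphD IH -mul_mpolyC !rmorphM /= fgC mpolyXE_id !rmorph_prod /=.
by congr (_ * _ + _); apply: eq_bigr => i _; rewrite !rmorphXn /= fgX.
Qed.

Variable y : nat -> K.

Definition peval n : mpoly n C0 -> K := mmap iota (fun i : 'I_n => y i).

HB.instance Definition _ n := GRing.RMorphism.on (@peval n).

Lemma pevalC n c : peval (mpolyC n c) = iota c.
Proof. exact: mmapC. Qed.

Lemma pevalX n i : peval (mpolyX C0 (mnm1 i) : mpoly n C0) = y i.
Proof. by rewrite /peval mmapX mmap1U. Qed.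

Lemma muniX n (i : 'I_n.+1) : muni (mpolyX C0 (mnm1 i)) =
  if insub (val i) is Some j then (mpolyX C0 (mnm1 (j : 'I_n)))%:P else 'X.
Proof.
rewrite /muni mmapX mmap1U.
case: splitP => [j /= ij|j /= ij].
  by rewrite ij valK.
by rewrite insubN// ij ord1 addn0 ltnn.
Qed.

Lemma mwidenU n (i : 'I_n) : mwiden (mpolyX C0 (mnm1 i)) =
  mpolyX C0 (mnm1 (widen_ord (leqnSn n) i)).
Proof. by rewrite mwidenX mnmwiden1. Qed.

Lemma peval_muni n (P : mpoly n.+1 C0) :
  peval P = (map_poly (@peval n) (muni P)).[y n].
Proof.
rewrite -[RHS]/((horner_eval (y n) \o map_poly (@peval n) \o @muni n C0) P).
apply: (mpoly_morph_ext (f := @peval n.+1)) => [c|i] /=.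
  by rewrite muniC map_polyC /horner_eval hornerC /= !pevalC.
rewrite pevalX muniX; case: insubP => [j jn ij|ni].
  by rewrite map_polyC /horner_eval hornerC /= pevalX ij.
rewrite map_polyX /horner_eval hornerX; congr y; apply/eqP.
by have := ltn_ord i; rewrite ltnS leq_eqVlt (negbTE ni) orbF.
Qed.

(** The inverse of muni: a polynomial in the last variable, with coefficients in the
    others, as a polynomial in all the variables. *)
Definition mfold n (p : {poly (mpoly n C0)}) : mpoly n.+1 C0 :=
  (map_poly (@mwiden n C0) p).[mpolyX C0 (mnm1 ord_max)].

Lemma mfoldK n (p : {poly (mpoly n C0)}) : muni (mfold p) = p.
Proof.
rewrite /mfold -horner_map -map_poly_comp /= muniX insubN ?ltnn//.
rewrite (eq_map_poly (g := polyC)); last first.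
  apply: (mpoly_morph_ext (f := @muni n C0 \o @mwiden n C0)) => [c|i] /=.
    by rewrite mwidenC muniC.
  rewrite mwidenU muniX /=; case: insubP => [j _ /val_inj ->//|].
  by rewrite ltn_ord.
by rewrite -[RHS]comp_polyXr.
Qed.

Lemma muniK n (P : mpoly n.+1 C0) : mfold (muni P) = P.
Proof.
rewrite -[LHS]/((horner_eval (mpolyX C0 (mnm1 ord_max)) \o
   map_poly (@mwiden n C0) \o @muni n C0) P) -[RHS]/(idfun P).
apply: mpoly_morph_ext => [c|i] /=.
  by rewrite muniC map_polyC /horner_eval hornerC /= mwidenC.
rewrite muniX; case: insubP => [j jn ij|ni].
  rewrite map_polyC /horner_eval hornerC /= mwidenU; congr (mpolyX _ (mnm1 _)).
  exact: val_inj.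
rewrite map_polyX /horner_eval hornerX; congr (mpolyX _ (mnm1 _)).
apply/esym/val_inj/eqP => /=.
by have := ltn_ord i; rewrite ltnS leq_eqVlt (negbTE ni) orbF.
Qed.

Let Cst := constants iota.
Let sC := subfield_constants iota.
Let prefix n := mkseq y n.

Lemma peval_generated n (P : mpoly n C0) : generated Cst (prefix n) (peval P).
Proof.
have sG := subfield_generated (prefix n) sC.
rewrite /peval /mmap; apply: subfield_sum => // m _; apply: subfieldM => //.
  by apply: generated_sub => //; eexists.
rewrite /mmap1; elim/big_rec: _ => [|i u _ Gu]; first exact: subfield1.
apply: subfieldM => //; apply: subfieldX => //; apply: generated_mem => //.
by apply/mapP; exists (val i) => //; rewrite mem_iota /=.
Qed.

Lemma generated_peval n u : generated Cst (prefix n) u ->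
  exists P Q : mpoly n C0, peval Q != 0 /\ u = peval P / peval Q.
Proof.
apply: (@generated_least _ Cst (fun u => exists P Q : mpoly n C0,
  peval Q != 0 /\ u = peval P / peval Q)).
- split.
  + by exists 1, 1; rewrite rmorph1 oner_eq0 divr1.
  + move=> _ _ [P [Q [Q0 ->]]] [P' [Q' [Q'0 ->]]].
    exists (P * Q' - P' * Q), (Q * Q').
    by rewrite rmorphB !rmorphM mulf_neq0//; split=> //=; field; rewrite Q0 Q'0.
  + move=> _ _ [P [Q [Q0 ->]]] [P' [Q' [Q'0 ->]]].
    have [P'0|P'0] := eqVneq (peval P') 0.
      exists 0, 1; rewrite rmorph1 oner_eq0 rmorph0; split=> //.
      by rewrite P'0 !mul0r invr0 mulr0.
    exists (P * Q'), (Q * P'); rewrite !rmorphM mulf_neq0//; split=> //=.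
    by field; rewrite Q0 Q'0 P'0.
- move=> _ [c ->]; exists (mpolyC n c), 1.
  by rewrite rmorph1 oner_eq0 divr1 pevalC.
move=> t /mapP [j]; rewrite mem_iota /= add0n => jn ->.
exists (mpolyX C0 (mnm1 (Ordinal jn))), 1.
by rewrite rmorph1 oner_eq0 divr1 pevalX.
Qed.

(** Order the relation by powers of the last variable.  If some coefficient is
    nonzero at y, the last term is algebraic over the preceding ones; otherwise
    the leading coefficient is a relation in fewer variables. *)
Lemma mpoly_relation_algebraic n (P : mpoly n C0) : P != 0 -> peval P = 0 ->
  exists2 i, (i < n)%N & algebraic (generated Cst (prefix i)) (y i).
Proof.
elim: n P => [|n IH] P P0 Py.
  have [c cP] : exists c, P = mpolyC 0 c.
    elim/mpolyind: P {P0 Py} => [|c m p _ _ [b ->]]; first by exists 0; rewrite mpolyC0.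
    exists (c + b); rewrite mpolyCD -mul_mpolyC (_ : m = @mnm0 0) ?mpolyX0 ?mulr1//.
    by apply/mnmP => -[].
  move: Py P0; rewrite cP pevalC => /eqP; rewrite fmorph_eq0 => /eqP ->.
  by rewrite mpolyC0 eqxx.
have p0 : muni P != 0 by apply: contra_neq P0 => p0; rewrite -[P]muniK p0 /mfold rmorph0 horner0.
have [q0|q0] := eqVneq (map_poly (@peval n) (muni P)) 0; last first.
  exists n => //; exists (map_poly (@peval n) (muni P)); split=> //.
    by move=> i; rewrite coef_map; exact: peval_generated.
  by rewrite rootE -peval_muni Py.
have [||i ni ai] := IH (lead_coef (muni P)); first by rewrite lead_coef_eq0.
  have := congr1 (fun p : {poly K} => p`_(size (muni P)).-1) q0.
  by rewrite /= coef_map coef0.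
by exists i => //; exact: ltnW.
Qed.

Lemma algebraic_mpoly_relation n : algebraic (generated Cst (prefix n)) (y n) ->
  exists P : mpoly n.+1 C0, P != 0 /\ peval P = 0.
Proof.
move=> [p [p0 Fp py]].
have [||||b [_ b0 Hb]] := @common_denominator _ (fun u => exists P : mpoly n C0, u = peval P) p.
- by exists 0; rewrite rmorph0.
- by exists 1; rewrite rmorph1.
- by move=> _ _ [P ->] [Q ->]; exists (P * Q); rewrite rmorphM.
- move=> i; have [P [Q [Q0 ->]]] := generated_peval (Fp i).
  by exists (peval P), (peval Q); split=> //; [exists P|exists Q].
have [f Hf] := choice Hb.
pose q := \poly_(i < size p) f i.
have qE : map_poly (@peval n) q = b *: p.
  apply/polyP => i; rewrite coef_map coef_poly coefZ /=.
  case: ifP => [_|/negbT ip]; first by rewrite -Hf.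
  by rewrite nth_default ?mulr0 ?rmorph0// leqNgt.
exists (mfold q); rewrite peval_muni mfoldK qE hornerZ (rootP py) mulr0; split=> //.
apply: contra_neq p0 => q0.
have /eqP : b *: p = 0 by rewrite -qE -[q]mfoldK q0 rmorph0 rmorph0.
by rewrite scaler_eq0 (negbTE b0) => /eqP.
Qed.

End MpolyDependence.

(** * Functions and their classes *)
Section Bridge.
Variable R : realType.
Local Notation C := (Cplx R).
Implicit Types (f g : C -> C) (u v : mero R).

(** Relating f to its class through a relation, rather than through cls, lets the
    meromorphy of compound functions be established along their structure. *)
Definition represents f u := exists mf : meromorphic f, cls mf = u.

Lemma represents_cls f (mf : meromorphic f) : represents f (cls mf).
Proof. by exists mf. Qed.

Lemma represents_cst (c : C) : represents (fun=> c) (mero_cst c).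
Proof. exact: represents_cls. Qed.

Lemma representsD f g u v : represents f u -> represents g v ->
  represents (fun z => f z + g z) (u + v).
Proof. by move=> [mf <-] [mg <-]; exists (meromorphicD mf mg); rewrite -cls_add. Qed.

Lemma representsM f g u v : represents f u -> represents g v ->
  represents (fun z => f z * g z) (u * v).
Proof. by move=> [mf <-] [mg <-]; exists (meromorphicM mf mg); rewrite -cls_mul. Qed.

Lemma representsX f u n : represents f u -> represents (fun z => f z ^+ n) (u ^+ n).
Proof.
move=> fu; elim: n => [|n IH].
  by rewrite (_ : (fun=> _) = (fun=> 1)); [exact: represents_cst|apply/funext].
rewrite exprS (_ : (fun=> _) = (fun z => f z * f z ^+ n)); first exact: representsM.
by apply/funext => z; rewrite exprS.
Qed.

Lemma represents_sum (I : Type) (r : seq I) (F : I -> C -> C) (U : I -> mero R) :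
  (forall i, represents (F i) (U i)) ->
  represents (fun z => \sum_(i <- r) F i z) (\sum_(i <- r) U i).
Proof.
move=> FU; elim: r => [|i r IH].
  rewrite big_nil (_ : (fun=> _) = (fun=> 0)); first exact: represents_cst.
  by apply/funext => z; rewrite big_nil.
rewrite big_cons (_ : (fun=> _) = (fun z => F i z + \sum_(j <- r) F j z)).
  exact: representsD.
by apply/funext => z; rewrite big_cons.
Qed.

Lemma represents_prod (I : Type) (r : seq I) (F : I -> C -> C) (U : I -> mero R) :
  (forall i, represents (F i) (U i)) ->
  represents (fun z => \prod_(i <- r) F i z) (\prod_(i <- r) U i).
Proof.
move=> FU; elim: r => [|i r IH].
  rewrite big_nil (_ : (fun=> _) = (fun=> 1)); first exact: represents_cst.
  by apply/funext => z; rewrite big_nil.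
rewrite big_cons (_ : (fun=> _) = (fun z => F i z * \prod_(j <- r) F j z)).
  exact: representsM.
by apply/funext => z; rewrite big_cons.
Qed.

Lemma represents_der f u : represents f u -> represents (derive1 f) (mero_der u).
Proof. by move=> [mf <-]; exists (meromorphic_derive1 mf); rewrite -cls_der. Qed.

Lemma represents_dern n f u : represents f u ->
  represents (derive1n n f) (iter n (@mero_der R) u).
Proof. by move=> fu; elim: n => //= n IH; exact: represents_der. Qed.

Lemma represents_meval m (F : 'I_m -> C -> C) (U : 'I_m -> mero R) (P : mpoly m C) :
  (forall i, represents (F i) (U i)) ->
  represents (fun z => meval (fun i => F i z) P) (mmap (@mero_cst R) U P).
Proof.
move=> FU; rewrite /mmap (_ : (fun=> _) =
    (fun z => \sum_(k <- msupp P) mcoeff k P * \prod_i F i z ^+ fun_of_multinom k i)); last first.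
  by apply/funext => z; rewrite mevalE.
apply: represents_sum => k; apply: representsM; first exact: represents_cst.
by apply: represents_prod => i; exact: representsX.
Qed.

Lemma represents_eq f g u v : represents f u -> represents g v -> (meq f g <-> u = v).
Proof. by move=> [mf <-] [mg <-]; apply: iff_sym; exact: eq_cls. Qed.

Lemma diff_algebraicP f u : represents f u ->
  diff_algebraic f <-> diffalg (@mero_cst R) (@mero_der R) u.
Proof.
move=> fu; pose y j := iter j (@mero_der R) u.
have key m (P : mpoly m.+1 C) :
    meq (fun z => meval (fun i : 'I_m.+1 => derive1n i f z) P) (fun=> 0) <->
    peval (@mero_cst R) y P = 0.
  apply: represents_eq; last exact: represents_cst.
  by apply: represents_meval => i; exact: represents_dern.
split=> [[m [P [P0 /key Py]]]|[i ai]].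
  by have [i _ ai] := mpoly_relation_algebraic P0 Py; exists i.
have [P [P0 Py]] := @algebraic_mpoly_relation _ _ (@mero_cst R) y i ai.
by exists i, P; split=> //; apply/key.
Qed.

End Bridge.

(** * The theorem *)
Theorem theorem6p3 (R : realType) (n : nat) (B : 'M[Cplx R]_n.+1)
    (phi x : 'I_n.+1 -> Cplx R -> Cplx R)
    (phi_mero : forall i, meromorphic (phi i))
    (x_mero : forall i, meromorphic (x i))
    (phi1_DT : diff_transcendental (phi ord0))
    (phi_DA : forall i, i != ord0 -> diff_algebraic (phi i))
    (x_sol : forall i,
       meq (derive1 (x i)) (fun z => \sum_(l < n.+1) B i l * x l z + phi i z))
    (k : 'I_n.+1) (hk : k != ord0) :
  diff_algebraic (x k) <->
  (forall j : nat, (1 <= j <= n.+1)%N -> sum_coef B k j ord0 = 0).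
Proof.
pose X i := cls (x_mero i); pose Phi i := cls (phi_mero i).
have sol i : mero_der (X i) = \sum_(l < n.+1) mero_cst (B i l) * X l + Phi i.
  apply: (iffLR (represents_eq _ _) (x_sol i)).
    by apply: represents_der; exact: represents_cls.
  apply: representsD; last exact: represents_cls.
  apply: represents_sum => l; apply: representsM; last exact: represents_cls.
  exact: represents_cst.
pose DA := diffalg (@mero_cst R) (@mero_der R).
have xDA : diff_algebraic (x k) <-> DA (X k).
  by apply: diff_algebraicP; exact: represents_cls.
have phiDA i : diff_algebraic (phi i) <-> DA (Phi i).
  by apply: diff_algebraicP; exact: represents_cls.
have dD := @mero_derD R; have dM := @mero_derM R; have dC := @mero_der_cst R.
have elim := system_elimination dD dM dC sol k.
have linear := diffalg_linear dD dM dC (@mero_natr_neq0 R).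
have p0 : char_poly B != 0 by rewrite monic_neq0// char_poly_monic.
rewrite xDA -adj_char_eq0; split=> [xk|a0].
  apply: contrapT => /eqP a0; apply: phi1_DT; apply/phiDA.
  (* The elimination identity solved for the phi ord0 term: x k and the other
     phi s are on the right-hand side. *)
  pose Ls s := if s == ord0 then char_poly B else - (\adj (char_poly_mx B)) k s.
  pose ys s := if s == ord0 then X k else Phi s.
  apply: (linear _ xpredT _ Ls _ ys a0) => [|s _]; last first.
    by rewrite /ys; case: eqVneq => // s0; apply/phiDA/phi_DA.
  rewrite (bigD1 ord0)//= {1}/Ls {1}/ys !eqxx elim (bigD1 ord0)//= -addrA.
  rewrite -big_split big1 ?addr0//= => s /negbTE s0.
  by rewrite /Ls /ys s0 -actD subrr act0.
move: elim; rewrite (bigD1 ord0)//= a0 act0 add0r => elim.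
by apply: (linear _ _ _ _ _ _ p0 elim) => s s0; apply/phiDA/phi_DA.
Qed.
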